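(* Let $m\ge 3$, let $k$ be a non-zero real constant, and let $M$ be a Hopf hypersurface in the complex two-plane Grassmannian $G_2(\mathbb{C}^{m+2})$, that is, $A\xi=\alpha\xi$, where $\alpha=2k$, with GTW-Reeb parallel Ricci tensor, i.e. $\widehat\nabla^{(k)}_\xi S=0$. If $\xi\in\mathcal{Q}^\perp$, then the trace $h=\mathrm{Tr}\,A$ of the shape operator $A$ is constant along the direction of $\xi$, that is, $\xi h=0$.
   Context: $G_2(\mathbb{C}^{m+2})$ is the set of complex two-dimensional linear subspaces of $\mathbb{C}^{m+2}$ with its $SU(m+2)$-invariant Riemannian metric $g$, normalized so that the maximal sectional curvature is $8$. It carries a Kähler structure $J$ and a quaternionic Kähler structure $\mathfrak{J}$ (not containing $J$); for a local orthonormal basis $J_1,J_2,J_3$ of $\mathfrak J$ one has $JJ_\nu=J_\nu J$. Let $M$ be a real hypersurface (real codimension one) with induced metric $g$, local unit normal $N$, shape operator $A$, and Levi-Civita connection $\nabla$. The Reeb vector field is $\xi=-JN$, $\eta(X)=g(X,\xi)$, and the structure tensor $\phi$ is defined by letting $\phi X$ be the tangential part of $JX$. Put $\xi_\nu=-J_\nu N$ ($\nu=1,2,3$) and $\mathcal{Q}^\perp=\mathrm{Span}\{\xi_1,\xi_2,\xi_3\}$. The Ricci tensor is the $(1,1)$-tensor $SX=\sum_{i=1}^{4m-1}R(X,e_i)e_i$ for a local orthonormal frame $\{e_i\}$ of $M$. For a non-zero real constant $k$, the generalized Tanaka-Webster (GTW) connection on $M$ is $$\widehat\nabla^{(k)}_XY=\nabla_XY+g(\phi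 AX,Y)\xi-\eta(Y)\phi AX-k\eta(X)\phi Y,$$ and $(\widehat\nabla^{(k)}_XS)Y=\widehat\nabla^{(k)}_X(SY)-S(\widehat\nabla^{(k)}_XY)$. *)

(* Defs.v *)
From HB Require Import structures.
From mathcomp Require Import all_boot all_order all_algebra.
From mathcomp Require Import all_classical all_reals all_analysis.
From mathcomp Require Import complex.

Set Implicit Arguments.
Unset Strict Implicit.
Unset Printing Implicit Defensive.

Import Order.TTheory GRing.Theory Num.Theory.
Import numFieldNormedType.Exports.
Local Open Scope classical_set_scope.
Local Open Scope ring_scope.
Local Open Scope sesquilinear_scope.
Local Open Scope complex_scope.

(* A complex plane V in C^(m+2) is represented by the orthogonal projection
   onto V, so that G_2(C^(m+2)) is a submanifold of the real vector space of
   square complex matrices of size m+2. *)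
Notation cmx R m := 'M[R[i]]_(m.+2).

Definition grassmannian2 {R : realType} {m : nat} : set (cmx R m) :=
  [set P | [/\ P ^t* = P, P *m P = P & \rank P = 2]].

(* The derivative of P *m P = P; X = Z + Z^t* with Z in Hom(V, V^perp). *)
Definition gr_tangent {R : realType} {m : nat} (P : cmx R m) : set (cmx R m) :=
  [set X | X ^t* = X /\ X *m P + P *m X = X].

(* Invariant under P |-> U P U^t*.  For X = Z + Z^t* tangent, g X X is one half
   of Re tr (Z^t* Z); the metric Re tr (Z^t* Z) restricts to a complex
   projective line as a sphere of radius 1/2 and has maximal sectional
   curvature 4, so the factor 1/4 gives maximal sectional curvature 8. *)
Definition g {R : realType} {m : nat} (X Y : cmx R m) : R :=
  4%:R^-1 * complex.Re (\tr (X *m Y ^t*)).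

(* Z |-> 'i Z on Hom(V, V^perp). *)
Definition kahlerJ {R : realType} {m : nat} (P X : cmx R m) : cmx R m :=
  'i%C *: (X *m P - P *m X).

(* The factor su(V) of the isotropy algebra s(u(V) + u(V^perp)), acting on the
   tangent space by bracket, that is by Z |-> - Z B on Hom(V, V^perp). *)
Definition quaternionic {R : realType} {m : nat} (P : cmx R m) :
    set (cmx R m -> cmx R m) :=
  [set J | exists B : cmx R m,
     [/\ B ^t* = - B, \tr B = 0, P *m B = B, B *m P = B &
         forall X, gr_tangent P X -> J X = B *m X - X *m B]].

(* Orthonormality is for the inner product on the quaternionic structure whose
   unit vectors are the J with J o J = - id, that is
   J o J' + J' o J = - 2 <J, J'> id. *)
Definition quaternionic_basis {R : realType} {m : nat} (P : cmx R m)
    (J : 'I_3 -> cmx R m -> cmx R m) : Prop :=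
  (forall nu, quaternionic P (J nu)) /\
  (forall mu nu X, gr_tangent P X ->
     J mu (J nu X) + J nu (J mu X) = (- 2%:R * (mu == nu)%:R) *: X).

(* Orthogonal projection onto T, meant for real linear subspaces T. *)
Definition oproj {R : realType} {m : nat} (T : set (cmx R m)) (v : cmx R m) :
    cmx R m :=
  xget 0 [set w | T w /\ forall z, T z -> g (v - w) z = 0].

(* Smoothness on an open set U: all iterated directional derivatives of f
   exist and are differentiable at each point of U. *)
Definition smooth_on {R : realType} {n : nat} (U : set 'rV[R]_n)
    (f : 'rV[R]_n -> R) : Prop :=
  forall (s : seq 'rV[R]_n) (u : 'rV[R]_n), U u ->
    differentiable
      (foldr (fun w (h : 'rV[R]_n -> R) => fun x => 'D_w h x) f s) u.

(* The atlas is indexed by points: the chart of index p is a homeomorphism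
   par p from the open set dom p of R^n onto an open neighbourhood of p, with
   inverse coord p. *)
Record manifold (R : realType) (n : nat) := Manifold {
  pt :> topologicalType;
  dom : pt -> set 'rV[R]_n;
  par : pt -> 'rV[R]_n -> pt;
  coord : pt -> pt -> 'rV[R]_n;
  pt_hausdorff : hausdorff_space pt;
  pt_second_countable : @second_countable pt;
  dom_open : forall p, open (dom p);
  img_open : forall p, open (par p @` dom p);
  par_continuous : forall p u, dom p u -> {for u, continuous (par p)};
  coord_continuous : forall p q, (par p @` dom p) q ->
    {for q, continuous (coord p)};
  parK : forall p u, dom p u -> coord p (par p u) = u;
  img_center : forall p, (par p @` dom p) p;
  transition_smooth : forall p q i,
    smooth_on (dom p `&` par p @^-1` (par q @` dom q))
      (fun u => coord q (par p u) ord0 i)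
}.

Definition smooth {R : realType} {n : nat} {M : manifold R n} (W : set M)
    (f : M -> R) : Prop :=
  forall p : M, smooth_on (dom p `&` par p @^-1` W) (fun u => f (par p u)).

Definition smooth_mx {R : realType} {n m : nat} {M : manifold R n} (W : set M)
    (F : M -> cmx R m) : Prop :=
  forall i j, smooth W (fun p => complex.Re (F p i j)) /\
              smooth W (fun p => complex.Im (F p i j)).

Definition derive_mx {R : realType} {n m : nat} (F : 'rV[R]_n -> cmx R m)
    (w u : 'rV[R]_n) : cmx R m :=
  \matrix_(i, j) ('D_w (fun x => complex.Re (F x i j)) u +i*
                  'D_w (fun x => complex.Im (F x i j)) u).

Record hypersurface (R : realType) (m : nat) := Hypersurface {
  mfd :> manifold R (4 * m - 1)%N;
  imm : mfd -> cmx R m;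
  imm_grassmannian : forall p, grassmannian2 (imm p);
  imm_smooth : smooth_mx setT imm;
  imm_immersion : forall p w,
    derive_mx (fun u => imm (par p u)) w (coord p p) = 0 -> w = 0
}.

(* Tangent vectors of M at p are identified with their images under the
   differential of imm, and g is the induced metric.  coord_field p w is the
   vector field, defined around p, with constant components w in the chart
   of index p. *)
Definition coord_field {R : realType} {m : nat} {M : hypersurface R m} (p : M)
    (w : 'rV[R]_(4 * m - 1)) (q : M) : cmx R m :=
  derive_mx (fun u => imm (par p u)) w (coord p q).

Definition tangent {R : realType} {m : nat} {M : hypersurface R m} (p : M) :
    set (cmx R m) :=
  [set v | exists w, v = coord_field p w p].

Definition components {R : realType} {m : nat} {M : hypersurface R m} (p : M)
    (v : cmx R m) : 'rV[R]_(4 * m - 1) :=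
  xget 0 [set w | v = coord_field p w p].

(* Meaningful for v tangent at p only. *)
Definition dir {R : realType} {m : nat} {M : hypersurface R m} (f : M -> R)
    (p : M) (v : cmx R m) : R :=
  'D_(components p v) (fun u => f (par p u)) (coord p p).

Definition dir_mx {R : realType} {m : nat} {M : hypersurface R m}
    (F : M -> cmx R m) (p : M) (v : cmx R m) : cmx R m :=
  derive_mx (fun u => F (par p u)) (components p v) (coord p p).

Definition vector_field {R : realType} {m : nat} {M : hypersurface R m}
    (W : set M) (X : M -> cmx R m) : Prop :=
  smooth_mx W X /\ forall p, W p -> tangent p (X p).

(* X f = dir f _ (X _) on functions; applied to the entries of imm, whose
   derivative along X is X itself, X Y - Y X is the expression below. *)
Definition bracket {R : realType} {m : nat} {M : hypersurface R m}
    (X Y : M -> cmx R m) (p : M) : cmx R m :=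
  dir_mx Y p (X p) - dir_mx X p (Y p).

(* An orthonormal basis of the tangent space at p; the traces taken below do
   not depend on its choice. *)
Definition frame {R : realType} {m : nat} {M : hypersurface R m} (p : M) :
    'I_(4 * m - 1) -> cmx R m :=
  xget (fun=> 0) [set e | (forall i, tangent p (e i)) /\
                          (forall i j, g (e i) (e j) = (i == j)%:R)].

(* A connection acts on vector fields defined on open subsets W of M; its
   values outside W, or on other functions, are irrelevant. *)
Definition connection {R : realType} {m : nat} {M : hypersurface R m}
    (nabla : (M -> cmx R m) -> (M -> cmx R m) -> M -> cmx R m) : Prop :=
  forall (W : set M) (X Y Z : M -> cmx R m) (f : M -> R),
    open W -> vector_field W X -> vector_field W Y -> vector_field W Z ->
    smooth W f ->
    vector_field W (nabla X Y) /\
    forall p, W p ->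
      [/\ nabla (fun q => X q + Z q) Y p = nabla X Y p + nabla Z Y p,
          nabla (fun q => (f q)%:C *: X q) Y p = (f p)%:C *: nabla X Y p,
          nabla X (fun q => Y q + Z q) p = nabla X Y p + nabla X Z p &
          nabla X (fun q => (f q)%:C *: Y q) p =
            (dir f p (X p))%:C *: Y p + (f p)%:C *: nabla X Y p].

Definition metric_connection {R : realType} {m : nat} {M : hypersurface R m}
    (nabla : (M -> cmx R m) -> (M -> cmx R m) -> M -> cmx R m) : Prop :=
  forall (W : set M) (X Y Z : M -> cmx R m),
    open W -> vector_field W X -> vector_field W Y -> vector_field W Z ->
    forall p, W p ->
      dir (fun q => g (Y q) (Z q)) p (X p) =
        g (nabla X Y p) (Z p) + g (Y p) (nabla X Z p).

Definition torsion_free {R : realType} {m : nat} {M : hypersurface R m}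
    (nabla : (M -> cmx R m) -> (M -> cmx R m) -> M -> cmx R m) : Prop :=
  forall (W : set M) (X Y : M -> cmx R m),
    open W -> vector_field W X -> vector_field W Y ->
    forall p, W p -> nabla X Y p - nabla Y X p = bracket X Y p.

Definition levi_civita {R : realType} {m : nat} {M : hypersurface R m}
    (nabla : (M -> cmx R m) -> (M -> cmx R m) -> M -> cmx R m) : Prop :=
  [/\ connection nabla, metric_connection nabla & torsion_free nabla].

Definition curvature {R : realType} {m : nat} {M : hypersurface R m}
    (nabla : (M -> cmx R m) -> (M -> cmx R m) -> M -> cmx R m)
    (X Y Z : M -> cmx R m) (p : M) : cmx R m :=
  nabla X (nabla Y Z) p - nabla Y (nabla X Z) p - nabla (bracket X Y) Z p.

(* The curvature tensor on tangent vectors at p, which are extended to vector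
   fields with constant components in the chart of index p. *)
Definition riemann {R : realType} {m : nat} {M : hypersurface R m}
    (nabla : (M -> cmx R m) -> (M -> cmx R m) -> M -> cmx R m)
    (p : M) (x y z : cmx R m) : cmx R m :=
  let ext v := coord_field p (components p v) in
  curvature nabla (ext x) (ext y) (ext z) p.

Definition ricci {R : realType} {m : nat} {M : hypersurface R m}
    (nabla : (M -> cmx R m) -> (M -> cmx R m) -> M -> cmx R m)
    (p : M) (x : cmx R m) : cmx R m :=
  \sum_i riemann nabla p x (frame p i) (frame p i).

Definition unit_normal {R : realType} {m : nat} {M : hypersurface R m}
    (W : set M) (N : M -> cmx R m) : Prop :=
  smooth_mx W N /\
  forall p, W p ->
    [/\ gr_tangent (imm p) (N p), g (N p) (N p) = 1 &
        forall v, tangent p v -> g (N p) v = 0].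

(* Weingarten formula: A v is minus the covariant derivative of N along v in
   the Grassmannian, the Levi-Civita derivative of a submanifold of a Euclidean
   space being the tangential part of the derivative in that space. *)
Definition shape_operator {R : realType} {m : nat} {M : hypersurface R m}
    (N : M -> cmx R m) (p : M) (v : cmx R m) : cmx R m :=
  - oproj (gr_tangent (imm p)) (dir_mx N p v).

Definition trace_shape {R : realType} {m : nat} {M : hypersurface R m}
    (N : M -> cmx R m) (p : M) : R :=
  \sum_i g (shape_operator N p (frame p i)) (frame p i).

Definition reeb {R : realType} {m : nat} {M : hypersurface R m}
    (N : M -> cmx R m) (p : M) : cmx R m :=
  - kahlerJ (imm p) (N p).

Definition eta {R : realType} {m : nat} {M : hypersurface R m}
    (N : M -> cmx R m) (p : M) (x : cmx R m) : R :=
  g x (reeb N p).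

Definition phi {R : realType} {m : nat} {M : hypersurface R m}
    (p : M) (x : cmx R m) : cmx R m :=
  oproj (tangent p) (kahlerJ (imm p) x).

(* The span of xi_nu = - J_nu N, nu = 1, 2, 3. *)
Definition Qperp {R : realType} {m : nat} {M : hypersurface R m}
    (N : M -> cmx R m) (p : M) : set (cmx R m) :=
  [set x | exists (J : 'I_3 -> cmx R m -> cmx R m) (a : 'I_3 -> R),
     quaternionic_basis (imm p) J /\
     x = \sum_nu (a nu)%:C *: (- J nu (N p))].

Definition gtw {R : realType} {m : nat} {M : hypersurface R m}
    (nabla : (M -> cmx R m) -> (M -> cmx R m) -> M -> cmx R m)
    (N : M -> cmx R m) (k : R) (X Y : M -> cmx R m) (p : M) : cmx R m :=
  nabla X Y p
  + (g (phi p (shape_operator N p (X p))) (Y p))%:C *: reeb N p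
  - (eta N p (Y p))%:C *: phi p (shape_operator N p (X p))
  - (k * eta N p (X p))%:C *: phi p (Y p).

Definition gtw_tensor {R : realType} {m : nat} {M : hypersurface R m}
    (nabla : (M -> cmx R m) -> (M -> cmx R m) -> M -> cmx R m)
    (N : M -> cmx R m) (k : R) (S : M -> cmx R m -> cmx R m)
    (X Y : M -> cmx R m) (p : M) : cmx R m :=
  gtw nabla N k X (fun q => S q (Y q)) p - S p (gtw nabla N k X Y p).

(* Main.v *)
(* The Grassmannian sits in the flat space of Hermitian matrices, so the curvature
   of M can be read off the second derivatives of the immersion: their component
   normal to M at P is g(A x, y) N + (1 - 2P)(xy + yx).  The Gauss equation then
   gives, for a Hopf hypersurface,
     S xi = (c + alpha h - alpha^2) xi   with c constant,
   because xi in Q^perp forces the block of N in Hom(V, V^perp) to have rank one,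
   that is N^3 = 2N, so that the sectional curvature of span(xi, N) is always 8.
   Since nabla_xi xi = 0 and phi xi = 0, the hypothesis applied to Y = xi reads
   xi(c + alpha h - alpha^2) xi = 0, and alpha = 2k is a non-zero constant. *)
Require Import Defs.
From HB Require Import structures.
From mathcomp Require Import all_boot all_order all_algebra.
From mathcomp Require Import all_classical all_reals all_analysis.
From mathcomp Require Import complex ring lra zify.

Set Implicit Arguments.
Unset Strict Implicit.
Unset Printing Implicit Defensive.

Import Order.TTheory GRing.Theory Num.Theory.
Import numFieldNormedType.Exports.
Local Open Scope classical_set_scope.
Local Open Scope ring_scope.
Local Open Scope sesquilinear_scope.
Local Open Scope complex_scope.
Local Notation coord := Defs.coord.

(** * Smooth functions on open sets of R^n *)

(** The constant is c = 4m: the Grassmannian is Einstein with constant 4m + 8 in this metric, and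
    the curvature 8 of the plane of xi and N drops out because the Ricci trace of [M] omits the
    direction N. Two obstacles shape the rest. The connection [nabla] is an arbitrary operator
    satisfying the Levi-Civita axioms, so it is first identified, against tangent vectors, with the
    ambient directional derivative; curvature is then computed by differentiating matrices. Frames,
    projections and components are chosen pointwise, so no smoothness is visible in them: smoothness
    of h comes from chart expressions, and smoothness of S xi from its equality on [W] with a smooth
    multiple f xi. The derivative of f is then extracted by the ambient product rule tested against
    xi, where the term f nabla_xi xi vanishes. *)

Lemma near_differentiable (R : numFieldType) (V W : normedModType R)
    (f h : V -> W) (a : V) :
  (\near a, f a = h a) -> differentiable f a -> differentiable h a.
Proof.
move=> fh df.
have -> : h = f + (h - f) by apply/funext => x; rewrite !fctE addrC subrK.
apply: differentiableD => //.
have fha : f a = h a by exact: nbhs_singleton fh.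
have cz : continuous (\0 : V -> W) by move=> x; exact: cst_continuous.
(* The difference vanishes near [a], so the zero map serves as its differential with any little-o
   remainder. *)
have E : (h - f) \o shift a = cst ((h - f) a) + \0 +o_ 0 id.
  apply/eqaddoP => _/posnumP[e].
  have := fh; rewrite (near_shift 0) subr0 => fh0.
  near=> x.
  rewrite /= !fctE /= fha !subrr addr0 subr0.
  have -> : f (x + a) = h (x + a) by near: x.
  by rewrite subrr normr0 mulr_ge0.
have d0 : 'd (h - f) a = (\0 : V -> W) :> (V -> W) by exact: diff_unique cz E.
by apply/diff_locallyP; rewrite d0.
Unshelve. all: by end_near. Qed.

Section SmoothOn.
Context {R : realType} {n : nat}.
Notation V := 'rV[R]_n.
Implicit Types (U : set V) (f h : V -> R).

(** Differentiating a product, an inverse or a composite leaves undifferentiated factors behind, so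
    closure proofs need an induction on a finite order of differentiability; [smooth_on] offers only
    lists of directions. *)
Fixpoint smoothn (k : nat) U f : Prop :=
  (forall u, U u -> differentiable f u) /\
  if k is k'.+1 then forall w, smoothn k' U ('D_w f) else True.

Lemma smooth_onP U f : smooth_on U f <-> forall k, smoothn k U f.
Proof.
split=> [sf k|sf s].
  elim: k f sf => [|k IH] f sf; split=> //; try exact: (sf [::]).
  by move=> w; apply: IH => s u Uu; have := sf (rcons s w) u Uu; rewrite foldr_rcons.
move=> u Uu; have := sf (size s).
(* The last direction of the list is the first derivative taken of [f], whence the induction from
   the right end. *)
elim/last_ind: s f {sf} => [|s w IH] f; first by case=> /(_ u Uu).
by rewrite size_rcons foldr_rcons => -[_] /(_ w); exact: IH.
Qed.

Lemma smoothn_diff k U f u : smoothn k U f -> U u -> differentiable f u.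
Proof. by case: k => [|k] [+ _]; apply. Qed.

Lemma smoothnW k U f : smoothn k.+1 U f -> smoothn k U f.
Proof. by elim: k f => [|k IH] f [df sf]; split=> // w; exact/IH/sf. Qed.

Lemma eq_smoothn k U f h : open U -> (forall u, U u -> f u = h u) ->
  smoothn k U f -> smoothn k U h.
Proof.
move=> oU; have near_fh (f' h' : V -> R) : (forall u, U u -> f' u = h' u) ->
    forall u, U u -> \near u, f' u = h' u.
  move=> fh u Uu; have : \forall x \near u, U x by exact: open_nbhs_nbhs.
  by apply: filterS => x; exact: fh.
have dh f' h' : (forall u, U u -> f' u = h' u) ->
    (forall u, U u -> differentiable f' u) -> forall u, U u -> differentiable h' u.
  by move=> fh df u Uu; exact: (near_differentiable (near_fh _ _ fh u Uu) (df u Uu)).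
elim: k f h => [|k IH] f h fh [df sf]; split=> //; try exact: dh df.
move=> w; apply: IH (sf w) => u Uu; apply: near_eq_derive; exact: near_fh.
Qed.

Lemma smoothn_cst k U (c : R) : smoothn k U (fun=> c).
Proof.
have dc (a : R) u : differentiable (fun=> a : R) (u : V) by exact: differentiable_cst.
elim: k c => [|k IH] c; split=> // w.
suff -> : 'D_w (fun _ : V => c) = fun=> 0 by exact: IH.
by apply/funext => u; exact: derive_cst.
Qed.

Lemma smoothnD k U f h : open U -> smoothn k U f -> smoothn k U h ->
  smoothn k U (fun u => f u + h u).
Proof.
move=> oU; elim: k f h => [|k IH] f h [df sf] [dh sh]; split=> //;
  try by move=> u Uu; apply: differentiableD; [exact: df|exact: dh].
move=> w; apply: eq_smoothn (IH _ _ (sf w) (sh w)) => // u Uu.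
by rewrite -deriveD//; apply: diff_derivable; [exact: df|exact: dh].
Qed.

Lemma smoothnM k U f h : open U -> smoothn k U f -> smoothn k U h ->
  smoothn k U (fun u => f u * h u).
Proof.
move=> oU; have dM f' h' : (forall u, U u -> differentiable f' u) ->
    (forall u, U u -> differentiable h' u) ->
    forall u, U u -> differentiable (fun u => f' u * h' u) u.
  move=> df dh u Uu.
  have := differentiableM (df u Uu) (dh u Uu).
  by [].
elim: k f h => [|k IH] f h sf0 sh0.
  move: sf0 sh0 => [df sf] [dh sh]; split=> //; exact: dM.
move: (sf0) (sh0) => [df sf] [dh sh]; split; first exact: dM.
move=> w; apply: (@eq_smoothn _ _ (fun u => f u * 'D_w h u + h u * 'D_w f u)) => //.
  by move=> u Uu; rewrite (deriveM (diff_derivable (df u Uu)) (diff_derivable (dh u Uu))).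
by apply: smoothnD => //; apply: IH; do ?exact: smoothnW; [exact: sh|exact: sf].
Qed.

Lemma smoothnV k U f : open U -> (forall u, U u -> f u != 0) -> smoothn k U f ->
  smoothn k U (fun u => (f u)^-1).
Proof.
move=> oU f0; elim: k f f0 => [|k IH] f f0 sf0.
  move: sf0 => [df sf]; split=> // u Uu.
  by apply: differentiableV; [exact: df|exact: f0].
move: (sf0) => [df sf]; split.
  by move=> u Uu; apply: differentiableV; [exact: df|exact: f0].
move=> w; apply: (@eq_smoothn _ _ (fun u => -1 * ((f u)^-1 * (f u)^-1) * 'D_w f u)) => //.
  move=> u Uu; rewrite [RHS]deriveV ?f0//; last exact/diff_derivable/df.
  by rewrite expr2 invfM mulN1r.
have sV := IH f f0 (smoothnW sf0).
by apply: smoothnM (sf w) => //; apply: smoothnM (smoothn_cst _ _ _) _ => //; exact: smoothnM.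
Qed.

End SmoothOn.

Lemma differentiable_row (R : realType) (V : normedModType R) n (G : V -> 'rV[R]_n) u :
  (forall i, differentiable (fun x => G x ord0 i) u) -> differentiable G u.
Proof.
move=> dG.
have -> : G = \sum_(i < n) (fun x => G x ord0 i *: (delta_mx ord0 i : 'rV[R]_n)).
  by apply/funext => x; rewrite fct_sumE [LHS]row_sum_delta.
by apply: differentiable_sum => i; exact: differentiableZl.
Qed.

Lemma derive_comp_row (R : realType) n l (f : 'rV[R]_l -> R) (G : 'rV[R]_n -> 'rV[R]_l) u w :
  (forall i, differentiable (fun x => G x ord0 i) u) -> differentiable f (G u) ->
  'D_w (fun x => f (G x)) u =
    \sum_i 'D_w (fun x => G x ord0 i) u * 'D_(delta_mx ord0 i) f (G u).
Proof.
move=> dG df; have dG' := differentiable_row dG.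
rewrite deriveE; last exact: differentiable_comp.
rewrite (_ : (fun x => f (G x)) = f \o G)// diff_comp//=.
have -> : 'd G u w = \sum_i 'D_w (fun x => G x ord0 i) u *: (delta_mx ord0 i : 'rV[R]_l).
  rewrite [LHS]row_sum_delta; apply: eq_bigr => i _; congr (_ *: _).
  rewrite -deriveE// (@derive_mx _ _ _ _ G)//; first by rewrite mxE.
  exact: diff_derivable.
rewrite linear_sum; apply: eq_bigr => i _; rewrite linearZ /=.
by rewrite -[in LHS](deriveE _ df).
Qed.

(** By the chain rule a derivative of the composite is a sum of products of a derivative of [G] with
    a partial derivative of [f] along [G]. The induction therefore generalizes [f] and keeps [G]
    fixed. *)
Lemma smoothn_comp (R : realType) n l k (U : set 'rV[R]_n) (U' : set 'rV[R]_l)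
    (f : 'rV[R]_l -> R) (G : 'rV[R]_n -> 'rV[R]_l) :
  open U -> (forall u, U u -> U' (G u)) ->
  (forall i, smoothn k U (fun u => G u ord0 i)) -> smoothn k U' f ->
  smoothn k U (fun u => f (G u)).
Proof.
move=> oU UU'; elim: k f => [|k IH] f sG sf.
  split=> // u Uu; apply: (@differentiable_comp _ _ _ _ G f).
    by apply: differentiable_row => i; exact: smoothn_diff (sG i) Uu.
  exact: smoothn_diff sf (UU' _ Uu).
split=> [u Uu|w].
  apply: (@differentiable_comp _ _ _ _ G f).
    by apply: differentiable_row => i; exact: smoothn_diff (sG i) Uu.
  exact: smoothn_diff sf (UU' _ Uu).
apply: (@eq_smoothn _ _ _ _ (fun u => \sum_i
    ('D_w (fun x => G x ord0 i) u * 'D_(delta_mx ord0 i) f (G u)))) => //.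
  move=> u Uu; rewrite -derive_comp_row// => [i|].
  - exact: smoothn_diff (sG i) Uu.
  - exact: smoothn_diff sf (UU' _ Uu).
have sum_smooth (s : seq 'I_l) : smoothn k U (fun u => \sum_(i <- s)
    ('D_w (fun x => G x ord0 i) u * 'D_(delta_mx ord0 i) f (G u))).
  elim: s => [|i s IHs].
    apply: (@eq_smoothn _ _ _ _ (fun=> 0)) => // [u _|]; first by rewrite big_nil.
    exact: smoothn_cst.
  apply: (@eq_smoothn _ _ _ _ (fun u =>
    'D_w (fun x => G x ord0 i) u * 'D_(delta_mx ord0 i) f (G u) + \sum_(i <- s)
    ('D_w (fun x => G x ord0 i) u * 'D_(delta_mx ord0 i) f (G u)))) => //.
    by move=> u _; rewrite big_cons.
  apply: smoothnD => //; apply: smoothnM => //; first exact: (sG i).2.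
  by apply: (IH ('D_(delta_mx ord0 i) f)) => [j|]; [exact/smoothnW/sG|exact: sf.2].
exact: sum_smooth.
Qed.

Section SmoothOnTheory.
Context {R : realType} {n : nat}.
Notation V := 'rV[R]_n.
Implicit Types (U : set V) (f h : V -> R).

Lemma smooth_on_diff U f u : smooth_on U f -> U u -> differentiable f u.
Proof. by move=> /(_ [::] u). Qed.

Lemma smooth_on_sub U U' f : U' `<=` U -> smooth_on U f -> smooth_on U' f.
Proof. by move=> UU' sf s u /UU'; exact: sf. Qed.

Lemma smooth_on_derive U f w : smooth_on U f -> smooth_on U ('D_w f).
Proof. by move=> sf s u Uu; have := sf (rcons s w) u Uu; rewrite foldr_rcons. Qed.

Lemma eq_smooth_on U f h : open U -> (forall u, U u -> f u = h u) ->
  smooth_on U f -> smooth_on U h.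
Proof. by move=> oU fh /smooth_onP sf; apply/smooth_onP => k; exact: eq_smoothn (sf k). Qed.

Lemma smooth_on_cst U (c : R) : smooth_on U (fun=> c).
Proof. by apply/smooth_onP => k; exact: smoothn_cst. Qed.

Lemma smooth_onD U f h : open U -> smooth_on U f -> smooth_on U h ->
  smooth_on U (fun u => f u + h u).
Proof.
by move=> oU /smooth_onP sf /smooth_onP sh; apply/smooth_onP => k; exact: smoothnD.
Qed.

Lemma smooth_onM U f h : open U -> smooth_on U f -> smooth_on U h ->
  smooth_on U (fun u => f u * h u).
Proof.
by move=> oU /smooth_onP sf /smooth_onP sh; apply/smooth_onP => k; exact: smoothnM.
Qed.

Lemma smooth_onN U f : open U -> smooth_on U f -> smooth_on U (fun u => - f u).
Proof.
move=> oU sf; apply: (@eq_smooth_on _ (fun u => -1 * f u)) => //.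
  by move=> u _; rewrite mulN1r.
by apply: smooth_onM => //; exact: smooth_on_cst.
Qed.

Lemma smooth_onB U f h : open U -> smooth_on U f -> smooth_on U h ->
  smooth_on U (fun u => f u - h u).
Proof. by move=> oU sf sh; apply: smooth_onD => //; exact: smooth_onN. Qed.

Lemma smooth_onV U f : open U -> (forall u, U u -> f u != 0) -> smooth_on U f ->
  smooth_on U (fun u => (f u)^-1).
Proof. by move=> oU f0 /smooth_onP sf; apply/smooth_onP => k; exact: smoothnV. Qed.

Lemma smooth_on_sum U (I : Type) (s : seq I) (P : pred I) (F : I -> V -> R) : open U ->
  (forall i, smooth_on U (F i)) -> smooth_on U (fun u => \sum_(i <- s | P i) F i u).
Proof.
move=> oU sF; elim: s => [|i s IH].
  apply: (@eq_smooth_on _ (fun=> 0)) => // [u _|]; first by rewrite big_nil.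
  exact: smooth_on_cst.
have [Pi|nPi] := boolP (P i).
  apply: (@eq_smooth_on _ (fun u => F i u + \sum_(i <- s | P i) F i u)) => //.
    by move=> u _; rewrite big_cons Pi.
  exact: smooth_onD.
apply: eq_smooth_on IH => // u _; by rewrite big_cons (negbTE nPi).
Qed.

Lemma smooth_on_prod U (I : Type) (s : seq I) (P : pred I) (F : I -> V -> R) : open U ->
  (forall i, smooth_on U (F i)) -> smooth_on U (fun u => \prod_(i <- s | P i) F i u).
Proof.
move=> oU sF; elim: s => [|i s IH].
  apply: (@eq_smooth_on _ (fun=> 1)) => // [u _|]; first by rewrite big_nil.
  exact: smooth_on_cst.
have [Pi|nPi] := boolP (P i).
  apply: (@eq_smooth_on _ (fun u => F i u * \prod_(i <- s | P i) F i u)) => //.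
    by move=> u _; rewrite big_cons Pi.
  exact: smooth_onM.
apply: eq_smooth_on IH => // u _; by rewrite big_cons (negbTE nPi).
Qed.

Lemma smooth_on_det U k (A : V -> 'M[R]_k) : open U ->
  (forall i j, smooth_on U (fun u => A u i j)) -> smooth_on U (fun u => \det (A u)).
Proof.
move=> oU sA; apply: smooth_on_sum => // s; apply: smooth_onM => //.
  exact: smooth_on_cst.
exact: smooth_on_prod.
Qed.

(** Cramer's rule: an entry is a cofactor, polynomial in the entries of [A], divided by a
    determinant that does not vanish on [U]. *)
Lemma smooth_on_invmx U k (A : V -> 'M[R]_k) i j : open U ->
  (forall u, U u -> A u \in unitmx) ->
  (forall i j, smooth_on U (fun u => A u i j)) ->
  smooth_on U (fun u => invmx (A u) i j).
Proof.
move=> oU uA sA.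
apply: (@eq_smooth_on _ (fun u => (\det (A u))^-1 *
    ((-1) ^+ (j + i) * \det (row' j (col' i (A u)))))) => //.
  by move=> u /uA Au; rewrite /invmx Au !mxE.
apply: smooth_onM => //.
  apply: smooth_onV => //; last exact: smooth_on_det.
  by move=> u /uA; rewrite unitmxE unitfE.
apply: smooth_onM => //; first exact: smooth_on_cst.
apply: smooth_on_det => // i' j'.
by apply: eq_smooth_on (sA (lift j i') (lift i j')) => // u _; rewrite !mxE.
Qed.

End SmoothOnTheory.

Lemma smooth_on_comp (R : realType) n l (U : set 'rV[R]_n) (U' : set 'rV[R]_l)
    (f : 'rV[R]_l -> R) (G : 'rV[R]_n -> 'rV[R]_l) :
  open U -> (forall u, U u -> U' (G u)) ->
  (forall i, smooth_on U (fun u => G u ord0 i)) -> smooth_on U' f ->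
  smooth_on U (fun u => f (G u)).
Proof.
move=> oU UU' sG /smooth_onP sf; apply/smooth_onP => k.
apply: (smoothn_comp oU UU' _ (sf k)) => i; by have /smooth_onP := sG i.
Qed.

(* Symmetry of second derivatives: both mixed derivatives at nearby points equal
   the same second difference divided by h^2. *)
Section Schwarz.
Context {R : realType} {n : nat}.
Notation V := 'rV[R]_n.

Lemma is_derive_line (f : V -> R) (c v : V) (s : R) :
  derivable f (c + s *: v) v ->
  is_derive s 1 (fun t => f (c + t *: v)) ('D_v f (c + s *: v)).
Proof.
move=> df.
have E : (fun h : R => h^-1 *: (((fun t : R => f (c + t *: v)) \o shift s) (h *: (1 : R)) - f (c + s *: v)))
    = (fun h : R => h^-1 *: ((f \o shift (c + s *: v)) (h *: v) - f (c + s *: v))).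
  apply/funext => h /=; congr (_ *: (f _ - _)).
  by rewrite scaler1 scalerDl addrCA.
by apply: DeriveDef; rewrite /derivable /derive E.
Qed.

Lemma is_derive_translate (f : V -> R) (c v x : V) :
  derivable f (x + c) v -> is_derive x v (fun y => f (y + c)) ('D_v f (x + c)).
Proof.
move=> df.
have E : (fun h : R => h^-1 *: (((fun y => f (y + c)) \o shift x) (h *: v) - f (x + c)))
    = (fun h : R => h^-1 *: ((f \o shift (x + c)) (h *: v) - f (x + c))).
  by apply/funext => h /=; rewrite addrA.
by apply: DeriveDef; rewrite /derivable /derive E.
Qed.

Lemma line_mvt (f : V -> R) (c v : V) (h : R) : 0 < h ->
  (forall s, 0 <= s <= h -> derivable f (c + s *: v) v) ->
  exists2 s, 0 <= s <= h & f (c + h *: v) - f c = 'D_v f (c + s *: v) * h.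
Proof.
move=> h0 df.
have [||s sh] := @MVT R (fun t => f (c + t *: v)) (fun t => 'D_v f (c + t *: v)) 0 h h0.
- move=> s /[!in_itv] /= /andP[s0 sh]; apply: is_derive_line; apply: df.
  by rewrite !ltW.
- apply: continuous_in_subspaceT => s /set_mem /=; rewrite in_itv /= => sh.
  apply: differentiable_continuous.
  by have [/derivable1_diffP + _] := is_derive_line (df s sh).
rewrite scale0r addr0 subr0 => ->; exists s => //.
by move: sh; rewrite in_itv /= => /andP[s0 sh]; rewrite !ltW.
Qed.

Lemma square_mvt (U : set V) (f : V -> R) (u v w : V) (h : R) : smooth_on U f ->
  0 < h -> (forall s t, 0 <= s <= h -> 0 <= t <= h -> U (u + s *: v + t *: w)) ->
  exists s t, [/\ 0 <= s <= h, 0 <= t <= h &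
    f (u + h *: v + h *: w) - f (u + h *: v) - (f (u + h *: w) - f u) =
    'D_w ('D_v f) (u + s *: v + t *: w) * h * h].
Proof.
move=> sf h0 Ust.
have df x y : U x -> derivable f x y.
  by move=> Ux; apply: diff_derivable; exact: smooth_on_diff Ux.
have hh : 0 <= h <= h by rewrite lexx ltW.
have zh : 0 <= (0 : R) <= h by rewrite lexx ltW.
have U0 s : 0 <= s <= h -> U (u + s *: v).
  by move=> /Ust/(_ zh); rewrite scale0r addr0.
(* The second difference is the increment of [a] along [v]. One mean value theorem replaces it by an
   increment of ['D_v f] along [w], and a second one finishes. *)
pose a := (fun x => f (x + h *: w)) - f.
have da s : 0 <= s <= h ->
    is_derive (u + s *: v) v a ('D_v f (u + s *: v + h *: w) - 'D_v f (u + s *: v)).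
  move=> sh; apply: is_deriveB.
    by apply: is_derive_translate; exact/df/Ust.
  by apply: derivableP; exact/df/U0.
have [s sh E] : exists2 s, 0 <= s <= h & a (u + h *: v) - a u = 'D_v a (u + s *: v) * h.
  by apply: line_mvt => // s /da [].
have Da : 'D_v a (u + s *: v) = 'D_v f (u + s *: v + h *: w) - 'D_v f (u + s *: v).
  by have [_] := da s sh.
have [t th E2] := @line_mvt ('D_v f) (u + s *: v) w h h0
  (fun t th => diff_derivable (smooth_on_diff (smooth_on_derive v sf) (Ust s t sh th))).
by exists s, t; split=> //; rewrite -/(a (u + h *: v)) -/(a u) E Da E2.
Qed.

Lemma half_dist_le (a b c e : R) : `|a - c| < e / 2 -> `|b - c| < e / 2 -> `|a - b| <= e.
Proof.
rewrite (distrC b) => ac cb; apply/ltW.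
by rewrite (le_lt_trans (ler_distD c _ _))// [e]splitr ltrD.
Qed.

Lemma derive_comm (U : set V) (f : V -> R) (u v w : V) : open U -> smooth_on U f -> U u ->
  'D_w ('D_v f) u = 'D_v ('D_w f) u.
Proof.
move=> oU sf Uu; apply/eqP; rewrite -subr_eq0 -normr_le0; apply/ler_addgt0Pl => e e0.
rewrite addr0.
pose P := 'D_w ('D_v f); pose Q := 'D_v ('D_w f); change (`|P u - Q u| <= e).
have cP : {for u, continuous P}.
  exact/differentiable_continuous/(smooth_on_diff _ Uu)/smooth_on_derive/smooth_on_derive.
have cQ : {for u, continuous Q}.
  exact/differentiable_continuous/(smooth_on_diff _ Uu)/smooth_on_derive/smooth_on_derive.
have e20 : 0 < e / 2 by rewrite divr_gt0.
have nP : \forall x \near u, U x /\ (`|P u - P x| < e / 2 /\ `|Q u - Q x| < e / 2).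
  have nU : \forall x \near u, U x by exact: open_nbhs_nbhs.
  have nP : \forall x \near u, `|P u - P x| < e / 2 by move/cvgrPdist_lt: cP; apply.
  have nQ : \forall x \near u, `|Q u - Q x| < e / 2 by move/cvgrPdist_lt: cQ; apply.
  by apply: filterS3 nU nP nQ => x.
have /nbhs_ballP[r /= r0 br] := nP.
(* The step [h] keeps the parallelogram with sides [h *: v] and [h *: w] within distance r / 2 of
   [u]; the summand 1 makes [D] positive even when both directions vanish. *)
pose D := `|v| + `|w| + 1; have D0 : 0 < D by rewrite ltr_wpDl// addr_ge0.
pose h := r / 2 / D; have h0 : 0 < h by rewrite !divr_gt0.
have bst s t : 0 <= s <= h -> 0 <= t <= h -> ball u r (u + s *: v + t *: w).
  move=> /andP[s0 sh] /andP[t0 th]; rewrite -ball_normE /ball_/=.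
  rewrite -addrA opprD addNKr normrN (le_lt_trans (ler_normD _ _))//.
  rewrite !normrZ !ger0_norm//.
  apply: (@le_lt_trans _ _ (h * D)); last by rewrite divfK ?gt_eqF// ltr_pdivrMr// ltr_pMr// ltr1n.
  by rewrite /D !mulrDr -addrA lerD ?ler_wpM2r// ler_wpDr ?ler_wpM2r// mulr1 ltW.
have [s [t [sh th E1]]] := square_mvt sf h0 (fun s t sh th => (br _ (bst s t sh th)).1).
have bts s' t' : 0 <= s' <= h -> 0 <= t' <= h -> ball u r (u + s' *: w + t' *: v).
  by move=> ? ?; rewrite addrAC; exact: bst.
have [s' [t' [sh' th' E2]]] := square_mvt sf h0 (fun s t sh th => (br _ (bts s t sh th)).1).
(* The second difference is symmetric in the two directions, so both mean values agree after
   division by the square of [h]. *)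
have E : P (u + s *: v + t *: w) = Q (u + s' *: w + t' *: v).
  apply: (mulIf (lt0r_neq0 h0)); apply: (mulIf (lt0r_neq0 h0)).
  apply: etrans (esym E1) (etrans _ E2).
  rewrite (addrAC u (h *: w)); generalize (f u) (f (u + h *: v)) (f (u + h *: w)) => a b c.
  by generalize (f (u + h *: v + h *: w)) => d; ring.
have [_ [dP _]] := br _ (bst _ _ sh th).
have [_ [_ dQ]] := br _ (bts _ _ sh' th').
rewrite E in dP; exact: half_dist_le dP dQ.
Qed.

End Schwarz.

(** * The Grassmannian as a set of projections *)

Section MetricAlgebra.
Context {R : realType}.
Implicit Types a b : R.

Lemma conjCE (z : R[i]) : Num.conj z = conjc z.
Proof. by []. Qed.

Lemma trmxCM l n k (X : 'M[R[i]]_(l, n)) (Y : 'M[R[i]]_(n, k)) :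
  (X *m Y) ^t* = Y ^t* *m X ^t*.
Proof. by rewrite trmx_mul map_mxM. Qed.

Lemma trmxCD l n (X Y : 'M[R[i]]_(l, n)) : (X + Y) ^t* = X ^t* + Y ^t*.
Proof. by rewrite linearD /= map_mxD. Qed.

Lemma trmxCN l n (X : 'M[R[i]]_(l, n)) : (- X) ^t* = - X ^t*.
Proof. by rewrite linearN /= map_mxN. Qed.

Lemma trmxCB l n (X Y : 'M[R[i]]_(l, n)) : (X - Y) ^t* = X ^t* - Y ^t*.
Proof. by rewrite trmxCD trmxCN. Qed.

Lemma trmxCZ l n c (X : 'M[R[i]]_(l, n)) : (c *: X) ^t* = Num.conj c *: X ^t*.
Proof. by rewrite linearZ /= map_mxZ. Qed.

Lemma trmxC0 l n : (0 : 'M[R[i]]_(l, n)) ^t* = 0.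
Proof. by rewrite trmx0 map_mx0. Qed.

Lemma trmxC1 n : (1%:M : 'M[R[i]]_n) ^t* = 1%:M.
Proof. by rewrite trmx1 map_mx1. Qed.

Lemma trmxC_sum l n (I : Type) (r : seq I) (Q : pred I) (F : I -> 'M[R[i]]_(l, n)) :
  (\sum_(i <- r | Q i) F i) ^t* = \sum_(i <- r | Q i) (F i) ^t*.
Proof. by rewrite linear_sum map_mx_sum. Qed.

Lemma mxtrace_trmxC n (X : 'M[R[i]]_n) : \tr (X ^t*) = Num.conj (\tr X).
Proof. by rewrite trace_map_mx mxtrace_tr. Qed.

Lemma conj_realc a : Num.conj a%:C = a%:C :> R[i].
Proof. by rewrite conjCE conjc_real. Qed.

Lemma cReD (x y : R[i]) : complex.Re (x + y) = complex.Re x + complex.Re y.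
Proof. by case: x; case: y. Qed.
Lemma cImD (x y : R[i]) : complex.Im (x + y) = complex.Im x + complex.Im y.
Proof. by case: x; case: y. Qed.
Lemma cReN (x : R[i]) : complex.Re (- x) = - complex.Re x.
Proof. by case: x. Qed.
Lemma cImN (x : R[i]) : complex.Im (- x) = - complex.Im x.
Proof. by case: x. Qed.
Lemma cReZ a (x : R[i]) : complex.Re (a%:C * x) = a * complex.Re x.
Proof. by case: x => x y /=; ring. Qed.
Lemma cReM (x y : R[i]) : complex.Re (x * y) =
  complex.Re x * complex.Re y - complex.Im x * complex.Im y.
Proof. by case: x; case: y. Qed.
Lemma cImM (x y : R[i]) : complex.Im (x * y) =
  complex.Re x * complex.Im y + complex.Im x * complex.Re y.
Proof. by case: x => a b; case: y. Qed.
Lemma cRe_conj (x : R[i]) : complex.Re (Num.conj x) = complex.Re x.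
Proof. by case: x. Qed.
Lemma cIm_conj (x : R[i]) : complex.Im (Num.conj x) = - complex.Im x.
Proof. by case: x. Qed.
Lemma cRe_sum (I : Type) (r : seq I) (Q : pred I) (F : I -> R[i]) :
  complex.Re (\sum_(i <- r | Q i) F i) = \sum_(i <- r | Q i) complex.Re (F i).
Proof. exact: (big_morph _ cReD). Qed.
Lemma cIm_sum (I : Type) (r : seq I) (Q : pred I) (F : I -> R[i]) :
  complex.Im (\sum_(i <- r | Q i) F i) = \sum_(i <- r | Q i) complex.Im (F i).
Proof. exact: (big_morph _ cImD). Qed.

Context {m : nat}.
Implicit Types X Y Z : cmx R m.

Lemma gC X Y : g X Y = g Y X.
Proof.
by rewrite /g -{1}(trmxCK X) -trmxCM mxtrace_trmxC cRe_conj.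
Qed.

Lemma gDl X Y Z : g (X + Y) Z = g X Z + g Y Z.
Proof. by rewrite /g mulmxDl mxtraceD cReD mulrDr. Qed.

Lemma gZl a X Y : g (a%:C *: X) Y = a * g X Y.
Proof. by rewrite /g -scalemxAl mxtraceZ cReZ mulrCA. Qed.

Lemma gNl X Y : g (- X) Y = - g X Y.
Proof. by rewrite /g mulNmx linearN cReN mulrN. Qed.

Lemma g0l Y : g 0 Y = 0.
Proof. by rewrite /g mul0mx mxtrace0 mulr0. Qed.

Lemma gBl X Y Z : g (X - Y) Z = g X Z - g Y Z.
Proof. by rewrite gDl gNl. Qed.

Lemma gDr X Y Z : g X (Y + Z) = g X Y + g X Z.
Proof. by rewrite gC gDl !(gC X). Qed.

Lemma gZr a X Y : g X (a%:C *: Y) = a * g X Y.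
Proof. by rewrite gC gZl gC. Qed.

Lemma gNr X Y : g X (- Y) = - g X Y.
Proof. by rewrite gC gNl gC. Qed.

Lemma g0r X : g X 0 = 0.
Proof. by rewrite gC g0l. Qed.

Lemma gBr X Y Z : g X (Y - Z) = g X Y - g X Z.
Proof. by rewrite gDr gNr. Qed.

Lemma g_suml (I : Type) (r : seq I) (Q : pred I) (F : I -> cmx R m) Y :
  g (\sum_(i <- r | Q i) F i) Y = \sum_(i <- r | Q i) g (F i) Y.
Proof. by apply: (big_morph (g^~ Y)) => [? ?|]; rewrite ?gDl ?g0l. Qed.

Lemma g_sumr (I : Type) (r : seq I) (Q : pred I) (F : I -> cmx R m) X :
  g X (\sum_(i <- r | Q i) F i) = \sum_(i <- r | Q i) g X (F i).
Proof. by rewrite gC g_suml; apply: eq_bigr => i _; rewrite gC. Qed.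

Lemma gE X Y : g X Y = 4^-1 * \sum_i \sum_j
  (complex.Re (X i j) * complex.Re (Y i j) + complex.Im (X i j) * complex.Im (Y i j)).
Proof.
rewrite /g /mxtrace cRe_sum; congr (_ * _); apply: eq_bigr => i _.
rewrite mxE cRe_sum; apply: eq_bigr => j _.
by rewrite !mxE cReM cRe_conj cIm_conj mulrN opprK.
Qed.

Lemma g_ge0 X : 0 <= g X X.
Proof.
by rewrite gE mulr_ge0 ?invr_ge0//; do 2![apply: sumr_ge0 => ? _]; rewrite addr_ge0// -expr2 sqr_ge0.
Qed.

Lemma g_eq0 X : g X X = 0 -> X = 0.
Proof.
rewrite gE => /eqP; rewrite mulf_eq0 invr_eq0 pnatr_eq0 /= => /eqP g0.
have pos i j : 0 <= complex.Re (X i j) * complex.Re (X i j) + complex.Im (X i j) * complex.Im (X i j).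
  by rewrite addr_ge0// -expr2 sqr_ge0.
apply/matrixP => i j; rewrite mxE.
have /psumr_eq0P/(_ i isT) := g0; move=> /(_ (fun i _ => sumr_ge0 _ (fun j _ => pos i j))).
move/psumr_eq0P => /(_ (fun j _ => pos i j))/(_ j isT)/eqP.
rewrite -!expr2 paddr_eq0 ?sqr_ge0// !sqrf_eq0 => /andP[/eqP r0 /eqP i0].
by apply/eqP; rewrite eq_complex r0 i0 !eqxx.
Qed.

End MetricAlgebra.

Section GrassmannianPoint.
Context {R : realType} {m : nat}.
Implicit Types X Y Z P M : cmx R m.

(* The factor 2 normalizes the matrix units, as g carries a factor 1/4. *)
Definition std_basis (x : 'I_m.+2 * 'I_m.+2 * bool) : cmx R m :=
  (if x.2 then 2 else 2 * 'i%C) *: delta_mx x.1.1 x.1.2.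

Lemma std_basisT a b : std_basis (a, b, true) = 2 *: delta_mx a b.
Proof. by []. Qed.

Lemma std_basisF a b : std_basis (a, b, false) = (2 * 'i%C) *: delta_mx a b.
Proof. by []. Qed.

Lemma sum_std_basis (V : nmodType) (F : 'I_m.+2 * 'I_m.+2 * bool -> V) :
  \sum_x F x = \sum_a \sum_b (F (a, b, true) + F (a, b, false)).
Proof.
rewrite pair_bigA /=.
rewrite (eq_bigr (fun p : 'I_m.+2 * 'I_m.+2 => \sum_c F (p, c))); last first.
  by move=> [a b] _; rewrite big_bool.
by rewrite pair_bigA /=; apply: eq_bigr => -[[a b] c].
Qed.

Lemma delta_mul_delta (a b c d : 'I_m.+2) M :
  delta_mx a b *m M *m delta_mx c d = M b c *: (delta_mx a d : cmx R m).
Proof.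
apply/matrixP => i j; rewrite !mxE (bigD1 c)//= big1 ?addr0; last first.
  by move=> k kc; rewrite !mxE (negbTE kc) mulr0.
rewrite !mxE (bigD1 b)//= big1 ?addr0; last first.
  by move=> k kb; rewrite !mxE (negbTE kb) andbF mul0r.
by rewrite !mxE !eqxx andbT; case: (i == a); case: (j == d); rewrite /= ?mul1r ?mulr1 ?mul0r ?mulr0.
Qed.

Lemma scale_combine (a b c d e : R[i]) X : a = b * c + d * e ->
  a *: X = b *: (c *: X) + d *: (e *: X).
Proof. by move=> ->; rewrite scalerDl !scalerA. Qed.

Lemma std_basis_expand X : X = \sum_x (g X (std_basis x))%:C *: std_basis x.
Proof.
rewrite sum_std_basis [LHS]matrix_sum_delta; apply: eq_bigr => a _; apply: eq_bigr => b _.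
rewrite std_basisT std_basisF; apply: scale_combine.
have gd c : g X (c *: delta_mx a b) = 4^-1 * complex.Re (X a b * Num.conj c).
  rewrite /g trmxCZ -scalemxAr mxtraceZ mulrC mulrC; congr (_ * complex.Re _).
  rewrite mulrC; congr (_ * _).
  rewrite trmx_delta /mxtrace (bigD1 a)//= big1 ?addr0; last first.
    move=> k ka; rewrite !mxE big1// => l _.
    by rewrite !mxE (negbTE ka) andbF conjC0 mulr0.
  rewrite mxE (bigD1 b)//= big1 ?addr0; last first.
    by move=> k kb; rewrite !mxE (negbTE kb) conjC0 mulr0.
  by rewrite !mxE !eqxx conjC1 mulr1.
rewrite !gd !conjCE; case: (X a b) => u v; apply/eqP; rewrite eq_complex /=.
by apply/andP; split; apply/eqP; field.
Qed.

Lemma conj_2i : Num.conj (2 * 'i%C) = - (2 * 'i%C) :> R[i].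
Proof. by apply/eqP; rewrite conjCE eq_complex /=; apply/andP; split; apply/eqP; ring. Qed.

Lemma sqr_2i : 2 * 'i%C * (2 * 'i%C) = - 4 :> R[i].
Proof. by apply/eqP; rewrite eq_complex /=; apply/andP; split; apply/eqP; ring. Qed.

(** The summand is complex quadratic in the basis vector, so a matrix unit and its multiple by ['i]
    contribute opposite terms. *)
Lemma std_basis_mulC M : \sum_x std_basis x *m M *m std_basis x = 0.
Proof.
rewrite sum_std_basis big1// => a _; rewrite big1// => b _.
rewrite std_basisT std_basisF -!(scalemxAl, scalemxAr) !scalerA -scalerDl sqr_2i.
by rewrite (_ : 2 * 2 - 4 = 0) ?scale0r//; ring.
Qed.

Lemma sum_delta_diag : \sum_a delta_mx a a = 1%:M :> cmx R m.
Proof.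
apply/matrixP => i j; rewrite summxE !mxE (bigD1 i)//= big1 ?addr0; last first.
  by move=> k ki; rewrite mxE eq_sym (negbTE ki).
by rewrite mxE eqxx eq_sym.
Qed.

(** With one factor conjugated, a matrix unit and its multiple by ['i] contribute the same term; 8
    is twice the square of the normalizing factor 2. *)
Lemma std_basis_mul_adj M :
  \sum_x std_basis x *m M *m (std_basis x) ^t* = (8 * \tr M)%:M.
Proof.
rewrite sum_std_basis.
transitivity (\sum_a \sum_b (8 * M b b) *: (delta_mx a a : cmx R m)).
  apply: eq_bigr => a _; apply: eq_bigr => b _.
  rewrite std_basisT std_basisF !trmxCZ conj_2i conjC_nat.
  have -> : (delta_mx a b : cmx R m) ^t* = delta_mx b a.
    by apply/matrixP => i j; rewrite !mxE rmorph_nat andbC.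
  rewrite -!(scalemxAl, scalemxAr) !scalerA -scalerDl delta_mul_delta scalerA mulrN sqr_2i.
  congr (_ *: _); ring.
rewrite (eq_bigr (fun a => (8 * \tr M) *: (delta_mx a a : cmx R m))).
  by rewrite -scaler_sumr sum_delta_diag scalemx1.
by move=> a _; rewrite -scaler_suml -mulr_sumr.
Qed.

Lemma std_basis_adj_mul M :
  \sum_x (std_basis x) ^t* *m M *m std_basis x = (8 * \tr M)%:M.
Proof.
rewrite sum_std_basis exchange_big.
transitivity (\sum_b \sum_a (8 * M a a) *: (delta_mx b b : cmx R m)).
  apply: eq_bigr => b _; apply: eq_bigr => a _.
  rewrite std_basisT std_basisF !trmxCZ conj_2i conjC_nat.
  have -> : (delta_mx a b : cmx R m) ^t* = delta_mx b a.
    by apply/matrixP => i j; rewrite !mxE rmorph_nat andbC.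
  rewrite -!(scalemxAl, scalemxAr) !scalerA -scalerDl delta_mul_delta scalerA mulNr sqr_2i.
  congr (_ *: _); ring.
rewrite (eq_bigr (fun b => (8 * \tr M) *: (delta_mx b b : cmx R m))).
  by rewrite -scaler_sumr sum_delta_diag scalemx1.
by move=> a _; rewrite -scaler_suml -mulr_sumr.
Qed.

End GrassmannianPoint.

(** * The tangent space of the Grassmannian and traces over it *)

Section TangentProjection.
Context {R : realType} {m : nat}.
Implicit Types X Y Z P M : cmx R m.

Lemma grassmannian_trmxC P : grassmannian2 P -> P ^t* = P. Proof. by case. Qed.
Lemma grassmannian_idem P : grassmannian2 P -> P *m P = P. Proof. by case. Qed.

(** In [c r c r = c r] the full column rank of [c] and the full row rank of [r] allow cancelling the
    outer factors. *)
Lemma rank_factorization (F : fieldType) n (A : 'M[F]_n) k : \rank A = k -> A *m A = A ->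
  exists (c : 'M[F]_(n, k)) (r : 'M[F]_(k, n)), c *m r = A /\ r *m c = 1%:M.
Proof.
move=> <- AA; move: (mulmx_base A) (row_base_free A) (col_base_full A).
move: (col_base A) (row_base A) => c r cr rfree cfull; exists c, r; split=> //.
apply: (row_free_inj rfree); apply: (row_full_inj cfull).
by rewrite /= mul1mx !mulmxA cr -mulmxA cr.
Qed.

Lemma mxtrace_idempotent (F : fieldType) n (A : 'M[F]_n) :
  A *m A = A -> \tr A = (\rank A)%:R.
Proof.
move=> AA; have [c [r [cr rc]]] := rank_factorization erefl AA.
by rewrite -{1}cr mxtrace_mulC rc mxtrace1.
Qed.

Lemma grassmannian_tr P : grassmannian2 P -> \tr P = 2.
Proof. by case=> _ PP rP; rewrite mxtrace_idempotent// rP. Qed.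

(** The orthogonal projection onto the tangent space at [P]: the two off-diagonal blocks of the
    Hermitian part of [X]. *)
Definition gr_proj P X : cmx R m :=
  (2^-1 : R)%:C *: (P *m (X + X ^t*) *m (1%:M - P) + (1%:M - P) *m (X + X ^t*) *m P).

Lemma gr_tangent_trmxC P X : gr_tangent P X -> X ^t* = X. Proof. by case. Qed.

Lemma gr_tangent_mulr P X : gr_tangent P X -> X *m P = X - P *m X.
Proof. by case=> _ {2}<-; rewrite addrK. Qed.

Lemma gr_tangent_PXP P X : grassmannian2 P -> gr_tangent P X -> P *m X *m P = 0.
Proof.
move=> gP /gr_tangent_mulr E; rewrite -mulmxA E mulmxBr mulmxA.
by rewrite (grassmannian_idem gP) subrr.
Qed.

Lemma half2 X : (2^-1 : R)%:C *: (X + X) = X.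
Proof.
by rewrite -mulr2n -(scaler_nat _ X) scalerA fmorphV rmorph_nat mulVf ?scale1r// pnatr_eq0.
Qed.

Lemma gr_proj_tangent P X : grassmannian2 P -> gr_tangent P (gr_proj P X).
Proof.
move=> gP; have PP := grassmannian_idem gP; have Pt := grassmannian_trmxC gP.
split.
  rewrite trmxCZ conj_realc trmxCD !trmxCM !trmxCB trmxC1 trmxCD trmxCK Pt.
  by rewrite !mulmxA [X in _ *: X]addrC (addrC _ X).
rewrite -scalemxAl -scalemxAr -scalerDr; congr (_ *: _).
have QP : (1%:M - P) *m P = 0 by rewrite mulmxBl mul1mx PP subrr.
have PQ : P *m (1%:M - P) = 0 by rewrite mulmxBr mulmx1 PP subrr.
move: (X + X ^t*) (1%:M - P) QP PQ => Z Q QP PQ.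
rewrite mulmxDl mulmxDr !mulmxA -(mulmxA (P *m Z) Q P) QP mulmx0 add0r.
by rewrite -(mulmxA (Q *m Z) P P) PP PQ !mul0mx addr0 addrC.
Qed.

Lemma g_trmxC X Y : Y ^t* = Y -> g (X ^t*) Y = g X Y.
Proof. by move=> Yt; rewrite /g Yt -{1}Yt -trmxCM mxtrace_trmxC cRe_conj mxtrace_mulC. Qed.

Lemma mxtraceB n (A B : 'M[R[i]]_n) : \tr (A - B) = \tr A - \tr B.
Proof. exact: raddfB. Qed.

Lemma g_gr_proj P X Y : grassmannian2 P -> gr_tangent P Y -> g (gr_proj P X) Y = g X Y.
Proof.
move=> gP tY.
have PYP := gr_tangent_PXP gP tY.
have E Z : g (P *m Z *m (1%:M - P) + (1%:M - P) *m Z *m P) Y = g Z Y.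
  rewrite /g (gr_tangent_trmxC tY); congr (_ * complex.Re _).
  have Z0 : \tr (P *m Z *m P *m Y) = 0.
    by rewrite -!mulmxA mxtrace_mulC -!mulmxA (mulmxA P Y P) PYP mulmx0 mxtrace0.
  have -> : P *m Z *m (1%:M - P) + (1%:M - P) *m Z *m P =
      P *m Z + Z *m P - (P *m Z *m P + P *m Z *m P).
    by rewrite mulmxBr mulmx1 mulmxBl mul1mx mulmxBl addrACA opprD.
  rewrite mulmxBl mxtraceB !mulmxDl !mxtraceD Z0 addr0 subr0 -[in RHS]tY.2.
  rewrite mulmxDr mxtraceD; congr (_ + _); last by rewrite mulmxA.
  by rewrite -mulmxA mxtrace_mulC mulmxA.
rewrite /gr_proj gZl E gDl g_trmxC ?(gr_tangent_trmxC tY)//.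
by field.
Qed.

Lemma gr_tangentD P X Y : gr_tangent P X -> gr_tangent P Y -> gr_tangent P (X + Y).
Proof.
move=> [Xt EX] [Yt EY]; split; first by rewrite trmxCD Xt Yt.
by rewrite mulmxDl mulmxDr addrACA EX EY.
Qed.

Lemma gr_tangentZ P a X : gr_tangent P X -> gr_tangent P (a%:C *: X).
Proof.
move=> [Xt EX]; split; first by rewrite trmxCZ conj_realc Xt.
by rewrite -scalemxAl -scalemxAr -scalerDr EX.
Qed.

Lemma gr_tangentN P X : gr_tangent P X -> gr_tangent P (- X).
Proof.
move=> [Xt EX]; split; first by rewrite trmxCN Xt.
by rewrite mulNmx mulmxN -opprD EX.
Qed.

Lemma gr_tangent0 P : gr_tangent P 0.
Proof. by split; rewrite ?trmxC0// mul0mx mulmx0 addr0. Qed.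

Lemma gr_tangent_sum P (I : Type) (r : seq I) (Q : pred I) (F : I -> cmx R m) :
  (forall i, gr_tangent P (F i)) -> gr_tangent P (\sum_(i <- r | Q i) F i).
Proof.
move=> tF; elim/big_ind: _ => // [|X Y]; first exact: gr_tangent0.
exact: gr_tangentD.
Qed.

Lemma scale_mul_mul (c : R[i]) (A B C : cmx R m) :
  (c *: A) *m B *m C = c *: (A *m B *m C).
Proof. by rewrite -!scalemxAl. Qed.

(** With [W] the adjoint of [Z], this isolates products in which the basis vector encloses a fixed
    matrix; their sums over the standard basis are known. *)
Lemma proj_expand (P Q Z W M S : cmx R m) :
  (P *m (Z + W) *m Q + Q *m (Z + W) *m P) *m M *m S =
  P *m (Z *m (Q *m M) *m S) + P *m (W *m (Q *m M) *m S)
  + Q *m (Z *m (P *m M) *m S) + Q *m (W *m (P *m M) *m S).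
Proof. by rewrite !mulmxDr !mulmxDl !mulmxA addrA. Qed.

Lemma sum_proj_expand (I : finType) (a b c : R[i]) P Q (F1 F2 F3 F4 : I -> cmx R m) :
  \sum_x F1 x = 0 -> \sum_x F2 x = a%:M -> \sum_x F3 x = 0 -> \sum_x F4 x = b%:M ->
  \sum_x c *: (P *m F1 x + P *m F2 x + Q *m F3 x + Q *m F4 x) = c *: (a *: P + b *: Q).
Proof.
move=> E1 E2 E3 E4; rewrite -scaler_sumr !big_split /= -!mulmx_sumr E1 E2 E3 E4.
by rewrite !mulmx0 !mul_mx_scalar add0r !addr0.
Qed.

Lemma mxtrace_sum (I : finType) n (F : I -> 'M[R[i]]_n) :
  \tr (\sum_i F i) = \sum_i \tr (F i).
Proof. exact: raddf_sum. Qed.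

Section Complete.
Variables (P : cmx R m) (I : finType) (e : I -> cmx R m).
Hypothesis gP : grassmannian2 P.
Hypothesis te : forall i, gr_tangent P (e i).
Hypothesis oe : forall i j, g (e i) (e j) = (i == j)%:R.
Hypothesis cI : #|I| = (4 * m)%N.

Lemma gr_proj_std_basis_mul M :
  \sum_x gr_proj P (std_basis x) *m M *m std_basis x =
  4 *: ((\tr (P *m M)) *: (1%:M - P) + (\tr ((1%:M - P) *m M)) *: P).
Proof.
have E1 := @std_basis_mulC R m; have E2 := @std_basis_adj_mul R m.
move: std_basis E1 E2 => E E1 E2; set Q := 1%:M - P.
transitivity (\sum_x (2^-1 : R)%:C *:
   (P *m (E x *m (Q *m M) *m E x) + P *m ((E x) ^t* *m (Q *m M) *m E x)
   + Q *m (E x *m (P *m M) *m E x) + Q *m ((E x) ^t* *m (P *m M) *m E x))).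
  by apply: eq_bigr => x _; rewrite /gr_proj scale_mul_mul proj_expand.
apply: (etrans (sum_proj_expand _ _ _ (E1 (Q *m M)) (E2 (Q *m M)) (E1 (P *m M)) (E2 (P *m M)))).
rewrite addrC.
move: (\tr (Q *m M)) (\tr (P *m M)) => a b.
rewrite -!scalerA -scalerDr scalerA; congr (_ *: _).
by apply/eqP; rewrite eq_complex /=; apply/andP; split; apply/eqP; field.
Qed.

(** The left side is the trace of the orthogonal projection onto the tangent space, hence its real
    dimension, twice the complex dimension 2m of Hom(V, V^perp). *)
Lemma gr_proj_std_basis_g : \sum_x g (gr_proj P (std_basis x)) (std_basis x) = (4 * m)%:R.
Proof.
have E1 := @std_basis_mulC R m; have E2 := @std_basis_mul_adj R m.
move: std_basis E1 E2 => E E1 E2.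
rewrite /g -mulr_sumr -cRe_sum -mxtrace_sum; set Q := 1%:M - P.
have Qt : Q ^t* = Q by rewrite trmxCB trmxC1 (grassmannian_trmxC gP).
have Pt := grassmannian_trmxC gP.
set S := \sum_x _.
have -> : S = \sum_x (2^-1 : R)%:C *:
   (P *m (E x *m Q *m E x) ^t* + P *m (E x *m Q *m (E x) ^t*)
   + Q *m (E x *m P *m E x) ^t* + Q *m (E x *m P *m (E x) ^t*)).
  apply: eq_bigr => x _; rewrite -[gr_proj P _]mulmx1 /gr_proj scale_mul_mul.
  rewrite [E x + _]addrC proj_expand !mulmx1.
  by rewrite (trmxCM _ (E x)) (trmxCM _ Q) (trmxCM _ (E x)) (trmxCM _ P) Pt Qt !mulmxA.
have E3 M : \sum_x (E x *m M *m E x) ^t* = 0 by rewrite -trmxC_sum E1 trmxC0.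
rewrite (sum_proj_expand _ _ _ (E3 Q) (E2 Q) (E3 P) (E2 P)) mxtraceZ mxtraceD !mxtraceZ.
rewrite mxtraceB mxtrace1 (grassmannian_tr gP).
have -> : (m.+2%:R : R[i]) = m%:R + 2 by rewrite -natrD addn2.
have -> : (m%:R : R[i]) = (m%:R : R)%:C by rewrite rmorph_nat.
rewrite natrM; move: (m%:R : R) => a.
have -> : (2^-1)%:C * (8 * (a%:C + 2 - 2) * 2 + 8 * 2 * (a%:C + 2 - 2)) = (16 * a)%:C :> R[i].
  by apply/eqP; rewrite eq_complex /=; apply/andP; split; apply/eqP; field.
by rewrite /=; field.
Qed.

Lemma g_expansion (v : cmx R m) j : g (\sum_i (g v (e i))%:C *: e i) (e j) = g v (e j).
Proof.
rewrite g_suml (bigD1 j)//= big1 ?addr0; first by rewrite gZl oe eqxx mulr1.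
by move=> i ij; rewrite gZl oe (negbTE ij) mulr0.
Qed.

(** Bessel's identity, with [p] standing for the tangential projection of [v]. *)
Lemma g_remainder (v p : cmx R m) : g p p = g v p -> (forall j, g p (e j) = g v (e j)) ->
  let w := p - \sum_i (g v (e i))%:C *: e i in
  g w w = g p v - \sum_i g v (e i) * g v (e i).
Proof.
move=> pp pe w; have we j : g w (e j) = 0 by rewrite gBl g_expansion pe subrr.
rewrite {2}/w gBr g_sumr big1 ?subr0; last by move=> i _; rewrite gZr we mulr0.
rewrite gBl g_suml pp gC; congr (_ - _).
by apply: eq_bigr => i _; rewrite gZl (gC (e i)) pe.
Qed.

Lemma g_std_basis (v w : cmx R m) : g v w = \sum_x g v (std_basis x) * g (std_basis x) w.
Proof. by rewrite {1}(std_basis_expand v) g_suml; apply: eq_bigr => x _; rewrite gZl. Qed.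

(* An orthonormal family of 4m tangent vectors is complete: the orthogonal
   projection onto its span has trace 4m, which is also the trace of gr_proj P,
   so the remainder of gr_proj P vanishes on every basis vector. *)
Lemma complete_system X : gr_tangent P X -> X = \sum_i (g X (e i))%:C *: e i.
Proof.
move=> tX.
pose D x := gr_proj P (std_basis x) - \sum_i (g (std_basis x) (e i))%:C *: e i.
have gD x : g (D x) (D x) = g (gr_proj P (std_basis x)) (std_basis x)
    - \sum_i g (std_basis x) (e i) * g (std_basis x) (e i).
  have tp := gr_proj_tangent (std_basis x) gP.
  by apply: g_remainder => [|j]; rewrite g_gr_proj.
have sumD : \sum_x g (D x) (D x) = 0.
  rewrite (eq_bigr _ (fun x _ => gD x)) sumrB gr_proj_std_basis_g exchange_big /=.
  rewrite (eq_bigr (fun=> 1)) ?sumr_const ?cI ?subrr// => i _.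
  have oi : g (e i) (e i) = 1 by rewrite oe eqxx.
  rewrite -oi; set v := e i; rewrite [in RHS](g_std_basis v v).
  by apply: eq_bigr => x _; rewrite (gC v).
have D0 x : D x = 0.
  have gD0 := psumr_eq0P (fun y _ => g_ge0 (D y)) sumD.
  by apply: g_eq0; exact: gD0.
have pE x : gr_proj P (std_basis x) = \sum_i (g (std_basis x) (e i))%:C *: e i.
  by apply/eqP; rewrite -subr_eq0 -/(D x) D0.
apply/eqP; rewrite -subr_eq0; apply/eqP/g_eq0.
set Y := _ - _; have tY : gr_tangent P Y.
  apply: gr_tangentD => //; apply: gr_tangentN; apply: gr_tangent_sum => i.
  exact: gr_tangentZ.
have Ye j : g Y (e j) = 0 by rewrite gBl g_expansion subrr.
rewrite (g_std_basis Y Y) big1// => x _; rewrite -(g_gr_proj (std_basis x) gP tY) pE g_suml.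
by rewrite big1 ?mulr0// => i _; rewrite gZl (gC (e i)) Ye mulr0.
Qed.

(** Summing [e i] tensor [e i] gives the tensor of the orthogonal projection, and so does summing
    [gr_proj P E] tensor [E] over the standard basis. The contraction is therefore the same for
    both, and matrix units evaluate it. *)
Lemma complete_sum_mul M :
  \sum_i e i *m M *m e i = 4 *: ((\tr (P *m M)) *: (1%:M - P) + (\tr ((1%:M - P) *m M)) *: P).
Proof.
rewrite -gr_proj_std_basis_mul.
have pE x : gr_proj P (std_basis x) = \sum_i (g (std_basis x) (e i))%:C *: e i.
  have tp := gr_proj_tangent (std_basis x) gP.
  by rewrite {1}(complete_system tp); apply: eq_bigr => i _; rewrite g_gr_proj.
transitivity (\sum_i \sum_x (g (std_basis x) (e i))%:C *: (e i *m M *m std_basis x)).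
  apply: eq_bigr => i _; rewrite {2}(std_basis_expand (e i)) mulmx_sumr.
  by apply: eq_bigr => x _; rewrite -scalemxAr gC.
rewrite exchange_big /=; apply: eq_bigr => x _; rewrite pE !mulmx_suml.
by apply: eq_bigr => i _; rewrite scale_mul_mul.
Qed.

End Complete.
End TangentProjection.

Ltac mx_ring := apply/matrixP => ? ?; rewrite !mxE; ring.

(** * The second fundamental form of the Grassmannian in the Hermitian matrices *)

Section GrassmannianCurvature.
Context {R : realType} {m : nat}.
Implicit Types X Y Z P M N : cmx R m.

Definition gr_second_form P X Y : cmx R m :=
  (1%:M - (P + P)) *m (X *m Y + Y *m X).

(** Tangent vectors exchange V and its orthogonal complement, so a product of two of them preserves
    both. *)
Lemma tangent_mul_comm P X Y : gr_tangent P X -> gr_tangent P Y ->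
  P *m (X *m Y) = X *m Y *m P.
Proof.
move=> tX tY; have PX : P *m X = X - X *m P by rewrite -{2}tX.2 addrC addKr.
by rewrite mulmxA PX mulmxBl -!mulmxA (gr_tangent_mulr tY) mulmxBr.
Qed.

Lemma reflection_sqr P : grassmannian2 P ->
  (1%:M - (P + P)) *m (1%:M - (P + P)) = 1%:M.
Proof.
move=> gP; rewrite mulmxBr mulmx1 mulmxBl mul1mx mulmxDr !mulmxDl (grassmannian_idem gP).
by move: (1%:M) => I; mx_ring.
Qed.

Lemma reflection_trmxC P : grassmannian2 P ->
  (1%:M - (P + P)) ^t* = 1%:M - (P + P).
Proof. by move=> gP; rewrite trmxCB trmxCD trmxC1 (grassmannian_trmxC gP). Qed.

Lemma sym_prod_trmxC P X Y : gr_tangent P X -> gr_tangent P Y ->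
  (X *m Y + Y *m X) ^t* = X *m Y + Y *m X.
Proof. by move=> [Xt _] [Yt _]; rewrite trmxCD !trmxCM Xt Yt addrC. Qed.

Lemma sym_prod_comm P X Y : gr_tangent P X -> gr_tangent P Y ->
  P *m (X *m Y + Y *m X) = (X *m Y + Y *m X) *m P.
Proof. by move=> tX tY; rewrite mulmxDr mulmxDl !tangent_mul_comm. Qed.

(** The reflection 1 - 2P squares to the identity and cancels by cyclicity of the trace, which
    leaves a polynomial trace in the tangent vectors. *)
Lemma g_gr_second_form P X Y Z W : grassmannian2 P ->
  gr_tangent P X -> gr_tangent P Y -> gr_tangent P Z -> gr_tangent P W ->
  g (gr_second_form P X Y) (gr_second_form P Z W) =
  4^-1 * complex.Re (\tr ((X *m Y + Y *m X) *m (Z *m W + W *m Z))).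
Proof.
move=> gP tX tY tZ tW; rewrite /g /gr_second_form trmxCM (sym_prod_trmxC tZ tW).
rewrite (reflection_trmxC gP); congr (_ * complex.Re _).
by rewrite mulmxA mxtrace_mulC !mulmxA (reflection_sqr gP) mul1mx.
Qed.

Lemma block_diagonal_normal P K Z : grassmannian2 P -> gr_tangent P Z ->
  P *m K = K *m P -> g K Z = 0.
Proof.
move=> gP tZ PK; rewrite /g (gr_tangent_trmxC tZ).
have K0 : \tr (K *m P *m Z) = 0.
  rewrite -(grassmannian_idem gP) mulmxA -PK -!mulmxA mxtrace_mulC -!mulmxA.
  by rewrite (mulmxA P Z P) (gr_tangent_PXP gP tZ) mulmx0 mxtrace0.
have [_ tZ2] := tZ; rewrite -tZ2 mulmxDr mxtraceD !mulmxA K0 addr0 mxtrace_mulC mulmxA PK K0.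
by rewrite /= mulr0.
Qed.

Lemma gr_second_form_normal P X Y Z : grassmannian2 P ->
  gr_tangent P X -> gr_tangent P Y -> gr_tangent P Z -> g (gr_second_form P X Y) Z = 0.
Proof.
move=> gP tX tY tZ; apply: (block_diagonal_normal gP tZ); rewrite /gr_second_form.
have := sym_prod_comm tX tY; move: (X *m Y + Y *m X) => S PS.
by rewrite !(mulmxBl, mulmxBr) !mul1mx mulmxDl !mulmxDr !mulmxDl -!mulmxA PS.
Qed.

(* The hypothesis on D is what one gets by differentiating X P + P X = X along a
   tangent vector field X. *)
Lemma gr_decompose P D S : grassmannian2 P -> D ^t* = D ->
  D *m P + S + P *m D = D -> P *m S = S *m P ->
  D = gr_proj P D + (1%:M - (P + P)) *m S.
Proof.
move=> gP Dt E PS; have PP := grassmannian_idem gP.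
(* Sandwiching the hypothesis between two copies of [P] gives two such blocks on the left against
   one on the right. *)
have PDP : P *m D *m P = - (P *m S).
  have := congr1 (fun X => P *m X *m P) E.
  rewrite /= mulmxDr mulmxDl mulmxDr mulmxDl -!mulmxA PP !mulmxA PP -[RHS]add0r.
  rewrite (addrC (P *m D *m P)) => /addIr.
  by rewrite PS -!mulmxA PP mulmxA => /eqP; rewrite addrC addr_eq0 => /eqP.
have E1 : P *m (D + D) *m (1%:M - P) = P *m D + P *m D + (P *m S + P *m S).
  by rewrite mulmxBr mulmx1 mulmxDr mulmxDl PDP; congr (_ + _); rewrite opprB opprK.
have E2 : (1%:M - P) *m (D + D) *m P = D *m P + D *m P + (P *m S + P *m S).
  rewrite mulmxBl mul1mx mulmxDr mulmxBl !mulmxDl PDP; congr (_ + _).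
  by rewrite opprB opprK.
rewrite /gr_proj Dt E1 E2 mulmxBl mul1mx mulmxDl.
have -> : P *m D + P *m D + (P *m S + P *m S) + (D *m P + D *m P + (P *m S + P *m S))
   = (D *m P + P *m D + (P *m S + P *m S)) + (D *m P + P *m D + (P *m S + P *m S)).
  by move: (P *m S) (P *m D) (D *m P) => a b c; mx_ring.
rewrite half2 -{1}E; move: (P *m S) (P *m D) (D *m P) => a b c.
by mx_ring.
Qed.

End GrassmannianCurvature.

(** * Singular normal directions and the contraction giving the Ricci tensor *)

Section SingularDirections.
Context {R : realType} {m : nat}.
Implicit Types X Y Z P N : cmx R m.

Lemma rank_le1_factor (F : fieldType) n k (A : 'M[F]_(n, k)) : (\rank A <= 1)%N ->
  exists (u : 'M[F]_(n, 1)) (v : 'M[F]_(1, k)), A = u *m v.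
Proof.
move: (col_base A) (row_base A) (mulmx_base A); case: (\rank A) => [|[|]]// c r <- _.
  by exists 0, 0; rewrite mulmx0 (flatmx0 r) mulmx0.
by exists c, r.
Qed.

(* If J N = sum_nu a_nu J_nu N then i N P = - N B with B = sum_nu a_nu B_nu, and
   C = B + i P does not vanish since its trace is 2i. *)
Lemma quaternionic_annihilator P N (J : 'I_3 -> cmx R m -> cmx R m) (a : 'I_3 -> R) :
  grassmannian2 P -> gr_tangent P N -> (forall nu, quaternionic P (J nu)) ->
  - kahlerJ P N = \sum_nu (a nu)%:C *: (- J nu N) ->
  exists C : cmx R m, [/\ P *m C = C, C *m P = C, \tr C != 0 & N *m C = 0].
Proof.
move=> gP tN qJ E.
have /boolp.choice[B BP] : forall nu, exists B : cmx R m,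
    [/\ \tr B = 0, P *m B = B, B *m P = B & J nu N = B *m N - N *m B].
  move=> nu; have [B [_ tB PB BP JB]] := qJ nu; exists B; split=> //; exact: JB.
pose b : cmx R m := \sum_nu (a nu)%:C *: B nu.
have tb : \tr b = 0.
  by rewrite mxtrace_sum big1// => nu _; have [t0 _ _ _] := BP nu; rewrite mxtraceZ t0 mulr0.
have Pb : P *m b = b.
  rewrite mulmx_sumr; apply: eq_bigr => nu _; have [_ pb _ _] := BP nu.
  by rewrite -scalemxAr pb.
have bP : b *m P = b.
  rewrite mulmx_suml; apply: eq_bigr => nu _; have [_ _ pb _] := BP nu.
  by rewrite -scalemxAl pb.
have Eb : kahlerJ P N = b *m N - N *m b.
  apply: oppr_inj; rewrite E mulmx_sumr mulmx_suml -sumrB -sumrN; apply: eq_bigr => nu _.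
  have [_ _ _ ->] := BP nu; rewrite -scalemxAl -scalemxAr -scalerBr -scalerN.
  by [].
have PNP := gr_tangent_PXP gP tN.
exists (b + 'i%C *: P); split.
- by rewrite mulmxDr Pb -scalemxAr (grassmannian_idem gP).
- by rewrite mulmxDl bP -scalemxAl (grassmannian_idem gP).
- rewrite mxtraceD tb add0r mxtraceZ (grassmannian_tr gP).
  rewrite mulf_neq0 ?pnatr_eq0//.
  by rewrite eq_complex /= oner_eq0 andbF.
- have := congr1 (fun X => X *m P) Eb; rewrite /kahlerJ /= -scalemxAl !mulmxBl PNP subr0.
  rewrite -(mulmxA N P P) (grassmannian_idem gP) -(mulmxA N b) bP.
  have -> : b *m N *m P = 0 by rewrite -bP -!mulmxA (mulmxA P N P) PNP mulmx0.
  by rewrite sub0r mulmxDr -scalemxAr => ->; rewrite subrr.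
Qed.

(** A rank one block Z satisfies Z Z^* Z = |Z|^2 Z. The squared norm [s] of the block is half the
    trace of [N *m N], which is 4 because [g] carries the factor 1/4; hence the coefficient 2. *)
Lemma singular_cube P N C : grassmannian2 P -> gr_tangent P N -> g N N = 1 ->
  P *m C = C -> C *m P = C -> \tr C != 0 -> N *m C = 0 ->
  N *m N *m N = 2 *: N.
Proof.
move=> gP tN gN PC CP trC NC; have PP := grassmannian_idem gP.
have [_ _ rP] := gP; have [c [r [cr rc]]] := rank_factorization rP PP.
have [Nt tN2] := tN; have NNP := tangent_mul_comm tN tN.
have [u [v uv]] : exists (u : 'M[R[i]]_(m.+2, 1)) (v : 'M[R[i]]_(1, 2)), N *m c = u *m v.
  apply: rank_le1_factor.
  (* This is the 2 by 2 matrix of [C] acting on V. It is nonzero because [C] has nonzero trace, and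
     [N *m c] annihilates it, so [N *m c] has rank at most one. *)
  pose d := r *m C *m c.
  have d0 : d != 0.
    apply: contraNneq trC => d0.
    by rewrite -CP -cr mulmxA mxtrace_mulC mulmxA -/d d0 mxtrace0.
  have zd : N *m c *m d = 0.
    by rewrite /d !mulmxA -(mulmxA N) cr -(mulmxA N P C) PC NC mul0mx.
  have := mulmx0_rank_max zd; rewrite -mxrank_eq0 in d0; move: d0; case: (\rank d) => //= k _.
  by rewrite addnS ltnS => h; exact: leq_trans (leq_addr _ _) h.
have NP : N *m P = u *m (v *m r) by rewrite -cr !mulmxA uv.
move: (v *m r) NP => y NP {uv v}.
have PN : P *m N = y ^t* *m u ^t*.
  by rewrite -trmxCM -NP trmxCM Nt (grassmannian_trmxC gP).
pose s := \tr (P *m N *m (N *m P)).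
have sE : s = \tr (P *m N *m N).
  by rewrite /s mulmxA mxtrace_mulC !mulmxA PP.
have cube : (N *m P) *m (P *m N) *m (N *m P) = s *: (N *m P).
  rewrite /s PN NP !mulmxA.
  have [a e1] : exists a, y *m y ^t* = a%:M by eexists; exact: mx11_scalar.
  have [b e2] : exists b, u ^t* *m u = b%:M by eexists; exact: mx11_scalar.
  rewrite -(mulmxA u y) e1 -(mulmxA _ (u ^t*) u) e2 -(mulmxA (y ^t*) (u ^t*)) e2.
  rewrite !mul_mx_scalar -!scalemxAl mxtraceZ mxtrace_mulC e1 mxtrace_scalar mulr1n.
  by rewrite scalerA.
have trNN : \tr (N *m N) = s + s.
  rewrite -{1}tN2 mulmxDl mxtraceD sE; congr (_ + _).
  by rewrite -(mulmxA N P N) mxtrace_mulC.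
(* The normalization of [N] only controls the real part of [s]. *)
have sreal : Num.conj s = s.
  rewrite sE -mxtrace_trmxC !trmxCM Nt (grassmannian_trmxC gP) mulmxA mxtrace_mulC mulmxA.
  by [].
have s2 : s = 2.
  move: gN sreal; rewrite /g Nt trNN; case: (s) => x w /= e [] wE.
  by apply/eqP; rewrite eq_complex /=; apply/andP; split; apply/eqP; lra.
have cubeP : N *m N *m N *m P = 2 *: (N *m P).
  rewrite -[in RHS]s2 -cube -!mulmxA (mulmxA P P) PP.
  by rewrite (mulmxA N N P) (mulmxA P (N *m N) P) NNP -!mulmxA PP.
have cubePt : P *m N *m N *m N = 2 *: (P *m N).
  have := congr1 (fun X => X ^t*) cubeP; rewrite /= trmxCZ !trmxCM Nt (grassmannian_trmxC gP).
  by rewrite !mulmxA conjC_nat.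
transitivity (N *m N *m (N *m P) + N *m N *m (P *m N)); first by rewrite -mulmxDr tN2.
rewrite (mulmxA (N *m N) N P) cubeP (mulmxA (N *m N) P N) -NNP (mulmxA P N N) cubePt.
by rewrite -scalerDr tN2.
Qed.

Lemma kahlerJ_anticomm P N : gr_tangent P N ->
  N *m kahlerJ P N = - (kahlerJ P N *m N).
Proof.
move=> tN; have NNP := tangent_mul_comm tN tN.
rewrite /kahlerJ -scalemxAr -scalemxAl -scalerN mulmxBr mulmxBl opprB.
by rewrite (mulmxA N N P) -NNP !mulmxA.
Qed.

Lemma singular_sqr P N : N *m N *m N = 2 *: N ->
  P *m (N *m N) = N *m N *m P -> N *m N *m kahlerJ P N = 2 *: kahlerJ P N.
Proof.
move=> N3 NNP; rewrite /kahlerJ -scalemxAr scalerA [2 * _]mulrC -scalerA; congr (_ *: _).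
rewrite mulmxBr !mulmxA N3 -NNP -(mulmxA P) N3 scalerBr.
by rewrite -scalemxAl -scalemxAr.
Qed.

Lemma tangent_tr_mul P Z : grassmannian2 P -> gr_tangent P Z -> \tr (P *m Z) = 0.
Proof.
move=> gP tZ; rewrite -(grassmannian_idem gP) -mulmxA mxtrace_mulC.
by rewrite (gr_tangent_PXP gP tZ) mxtrace0.
Qed.

Lemma tangent_tr P Z : grassmannian2 P -> gr_tangent P Z -> \tr Z = 0.
Proof.
move=> gP tZ; have [_ {1}<-] := tZ.
by rewrite mxtraceD mxtrace_mulC tangent_tr_mul// addr0.
Qed.

Lemma tangent_tr_sym P X Y : gr_tangent P X ->
  \tr (P *m (X *m Y + Y *m X)) = \tr (X *m Y).
Proof.
move=> tX; have [_ tX2] := tX.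
have -> : \tr (X *m Y) = \tr (X *m P *m Y) + \tr (P *m X *m Y).
  by rewrite -{1}tX2 mulmxDl mxtraceD.
rewrite mulmxDr mxtraceD addrC mulmxA; congr (_ + _).
  by rewrite mxtrace_mulC -mulmxA mxtrace_mulC.
by rewrite mulmxA.
Qed.

Lemma mxtraceN k (A : 'M[R[i]]_k) : \tr (- A) = - \tr A.
Proof. exact: raddfN. Qed.

Section RicciSum.
Variables (n : nat) (P N : cmx R m) (e : 'I_n -> cmx R m).
Hypotheses (gP : grassmannian2 P) (tN : gr_tangent P N) (gN : g N N = 1).
Hypotheses (te : forall i, gr_tangent P (e i)) (eN : forall i, g N (e i) = 0).
Hypothesis (oe : forall i j, g (e i) (e j) = (i == j)%:R).
Hypothesis (n4m : n.+1 = (4 * m)%N).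

(** Adjoining the normal to a frame of the hypersurface gives 4m orthonormal vectors, so the results
    on complete systems apply; the normal term is then subtracted. *)
Let f (i : 'I_n.+1) : cmx R m := if unlift ord0 i is Some j then e j else N.

Let f0 : f ord0 = N. Proof. by rewrite /f unlift_none. Qed.
Let fS i : f (lift ord0 i) = e i. Proof. by rewrite /f liftK. Qed.
Let tf i : gr_tangent P (f i). Proof. by rewrite /f; case: unliftP. Qed.
Let of_ i j : g (f i) (f j) = (i == j)%:R.
Proof.
rewrite /f; case: unliftP => [i' ->|->]; case: unliftP => [j' ->|->].
- by rewrite oe (inj_eq lift_inj).
- by rewrite gC eN eq_sym (negbTE (neq_lift _ _)).
- by rewrite eN (negbTE (neq_lift _ _)).
- by rewrite gN eqxx.
Qed.
Let cf : #|'I_n.+1| = (4 * m)%N. Proof. by rewrite card_ord. Qed.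

Lemma normal_frame_expand X : gr_tangent P X ->
  X = (g X N)%:C *: N + \sum_i (g X (e i))%:C *: e i.
Proof.
move=> tX; rewrite {1}(complete_system gP tf of_ cf tX) big_ord_recl f0; congr (_ + _).
by apply: eq_bigr => i _; rewrite fS.
Qed.

Lemma normal_frame_sum_mul M : \sum_i e i *m M *m e i =
  4 *: ((\tr (P *m M)) *: (1%:M - P) + (\tr ((1%:M - P) *m M)) *: P) - N *m M *m N.
Proof.
rewrite -(complete_sum_mul gP tf of_ cf) big_ord_recl f0 addrC addKr.
by apply: eq_bigr => i _; rewrite fS.
Qed.

(** The Gauss terms are regrouped so that the summation vector [Z] occurs only as [Z *m M *m Z] with
    [M] fixed, the form contracted by [normal_frame_sum_mul]. The explicit identity matrix is one
    such [M]. *)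
Lemma ricci_term X Y Z : gr_tangent P X -> gr_tangent P Y -> gr_tangent P Z ->
  g (gr_second_form P Z Z) (gr_second_form P X Y) -
  g (gr_second_form P X Z) (gr_second_form P Z Y) =
  4^-1 * (complex.Re (\tr (Z *m 1%:M *m Z *m (X *m Y + Y *m X)))
          - 2 * complex.Re (\tr (X *m (Z *m Y *m Z)))).
Proof.
move=> tX tY tZ; rewrite !g_gr_second_form// -mulrBr; congr (_ * _).
have -> : \tr ((Z *m Z + Z *m Z) *m (X *m Y + Y *m X)) =
    2 * \tr (Z *m Z *m (X *m Y)) + 2 * \tr (Z *m Z *m (Y *m X)).
  by rewrite mulmxDl mxtraceD !mulmxDr !mxtraceD; ring.
have -> : \tr ((X *m Z + Z *m X) *m (Z *m Y + Y *m Z)) =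
    \tr (Z *m Z *m (X *m Y)) + \tr (Z *m Z *m (Y *m X)) + 2 * \tr (X *m (Z *m Y *m Z)).
  rewrite mulmxDl mxtraceD !mulmxDr !mxtraceD.
  have -> : \tr (X *m Z *m (Z *m Y)) = \tr (Z *m Z *m (Y *m X)).
    by rewrite -mulmxA mxtrace_mulC !mulmxA.
  have -> : \tr (X *m Z *m (Y *m Z)) = \tr (X *m (Z *m Y *m Z)) by rewrite !mulmxA.
  have -> : \tr (Z *m X *m (Z *m Y)) = \tr (X *m (Z *m Y *m Z)).
    by rewrite -mulmxA mxtrace_mulC !mulmxA.
  have -> : \tr (Z *m X *m (Y *m Z)) = \tr (Z *m Z *m (X *m Y)).
    by rewrite mulmxA mxtrace_mulC !mulmxA.
  by ring.
rewrite mulmx1 mulmxDr mxtraceD.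
move: (\tr (Z *m Z *m (X *m Y))) (\tr (Z *m Z *m (Y *m X))) (\tr (X *m (Z *m Y *m Z))).
by move=> [a a'] [b b'] [c c'] /=; ring.
Qed.

(** Over a full tangent basis the sum would have coefficient 4m + 8. The missing normal term equals
    8 by the relation [N *m N *m N = 2 *: N], and in equal parts: 4 from each of the two
    contractions. *)
Lemma gr_ricci_sum Y : N *m N *m N = 2 *: N -> gr_tangent P Y ->
  gr_tangent P (- kahlerJ P N) ->
  \sum_i (g (gr_second_form P (e i) (e i)) (gr_second_form P (- kahlerJ P N) Y) -
          g (gr_second_form P (- kahlerJ P N) (e i)) (gr_second_form P (e i) Y)) =
  (4 * m)%:R * g (- kahlerJ P N) Y.
Proof.
move=> N3 tY; have NNP := tangent_mul_comm tN tN.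
have NX := kahlerJ_anticomm tN; have NNX := singular_sqr N3 NNP.
set X := - kahlerJ P N => tX.
have {}NX : N *m X = - (X *m N) by rewrite /X mulmxN NX mulNmx.
have {}NNX : N *m N *m X = 2 *: X by rewrite /X mulmxN NNX scalerN.
clearbody X.
rewrite (eq_bigr _ (fun i _ => ricci_term tX tY (te i))) -mulr_sumr.
rewrite sumrB -mulr_sumr -!cRe_sum -!mxtrace_sum -mulmx_suml -mulmx_sumr.
rewrite !normal_frame_sum_mul.
have -> : \tr (P *m 1%:M) = 2 by rewrite mulmx1 (grassmannian_tr gP).
have -> : \tr ((1%:M - P) *m 1%:M) = m%:R.
  by rewrite mulmx1 mxtraceB mxtrace1 (grassmannian_tr gP) -addn2 natrD addrK.
(* The contraction of the off-diagonal matrix [Y] over the full basis vanishes, so only the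
   correction [N *m Y *m N] survives from it. *)
have -> : \tr (P *m Y) = 0 by exact: tangent_tr_mul.
have -> : \tr ((1%:M - P) *m Y) = 0.
  by rewrite mulmxBl mul1mx mxtraceB (tangent_tr gP tY) (tangent_tr_mul gP tY) subrr.
rewrite !scale0r addr0 scaler0 sub0r mulmx1 mulmxN mxtraceN mulmxBl mxtraceB.
have XN : X *m N = - (N *m X) by rewrite NX opprK.
have XNN : X *m N *m N = 2 *: X by rewrite XN mulNmx -mulmxA XN mulmxN opprK mulmxA NNX.
rewrite /g (gr_tangent_trmxC tY); set T := \tr (X *m Y).
have -> : \tr (X *m (N *m Y *m N)) = - (2 * T).
  rewrite mulmxA mxtrace_mulC !mulmxA -(mulmxA N X N) XN mulmxN mulNmx mxtraceN.
  by rewrite mulmxA NNX -scalemxAl mxtraceZ.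
have -> : \tr (N *m N *m (X *m Y + Y *m X)) = 4 * T.
  rewrite mulmxDr mxtraceD mulmxA NNX -scalemxAl mxtraceZ -/T.
  rewrite mulmxA mxtrace_mulC !mulmxA XNN -scalemxAl mxtraceZ -/T; ring.
have -> : \tr (4 *: (2 *: (1%:M - P) + m%:R *: P) *m (X *m Y + Y *m X)) =
    4 * (2 * T + m%:R * T).
  rewrite -scalemxAl mxtraceZ mulmxDl mxtraceD -!scalemxAl !mxtraceZ mulmxBl mul1mx mxtraceB.
  by rewrite tangent_tr_sym// mxtraceD (mxtrace_mulC Y X) -/T addrK.
have -> : (m%:R : R[i]) = (m%:R : R)%:C by rewrite rmorph_nat.
by rewrite natrM; move: (m%:R : R) T => a [x y] /=; field.
Qed.

End RicciSum.
End SingularDirections.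

(** * Derivatives of matrix-valued functions *)

Lemma is_derive_big (R : realType) (V : normedModType R) (I : Type) (s : seq I)
    (f : I -> V -> R) (df : I -> R) (u w : V) :
  (forall i, is_derive u w (f i) (df i)) ->
  is_derive u w (fun x => \sum_(i <- s) f i x) (\sum_(i <- s) df i).
Proof.
move=> Hf; elim: s => [|i s IH].
  rewrite big_nil (_ : (fun _ => _) = cst 0); first exact: is_derive_cst.
  by apply/funext => x; rewrite big_nil.
rewrite big_cons (_ : (fun _ => _) = f i + (fun x => \sum_(j <- s) f j x)); first exact: is_deriveD.
by apply/funext => x; rewrite big_cons.
Qed.

Lemma eq_Complex (R : realType) (a b c d : R) : a = c -> b = d -> (a +i* b) = (c +i* d).
Proof. by move=> -> ->. Qed.

Section MatrixCalculus.
Context {R : realType} {n m : nat}.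
Notation V := 'rV[R]_n.
Implicit Types (F G : V -> cmx R m) (f : V -> R) (u w : V) (A B : cmx R m).

(** Existence and value of the derivative travel together, so the product rules compose without
    separate differentiability conditions; the value agrees with [derive_mx] by [is_derive_cmxP]. *)
Definition is_derive_cmx F w u A : Prop := forall i j,
  is_derive u w (fun x => complex.Re (F x i j)) (complex.Re (A i j)) /\
  is_derive u w (fun x => complex.Im (F x i j)) (complex.Im (A i j)).

Definition differentiable_cmx F u : Prop := forall i j,
  differentiable (fun x => complex.Re (F x i j)) u /\
  differentiable (fun x => complex.Im (F x i j)) u.

Lemma derive_mxE F w u i j : Defs.derive_mx F w u i j =
  ('D_w (fun x => complex.Re (F x i j)) u +i* 'D_w (fun x => complex.Im (F x i j)) u).
Proof. by rewrite mxE. Qed.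

Lemma is_derive_cmxP F w u A : is_derive_cmx F w u A -> Defs.derive_mx F w u = A.
Proof.
move=> dF; apply/matrixP => i j; rewrite derive_mxE; have [[_ ->] [_ ->]] := dF i j.
by case: (A i j).
Qed.

Lemma differentiable_is_derive F w u : differentiable_cmx F u ->
  is_derive_cmx F w u (Defs.derive_mx F w u).
Proof.
move=> dF i j; have [d1 d2] := dF i j; rewrite derive_mxE /=.
by split; apply: derivableP; exact: diff_derivable.
Qed.

Lemma is_derive_cmx_cst A w u : is_derive_cmx (fun=> A) w u 0.
Proof. by move=> i j; rewrite mxE; split; exact: is_derive_cst. Qed.

Lemma is_derive_cmxD F G w u A B : is_derive_cmx F w u A -> is_derive_cmx G w u B ->
  is_derive_cmx (fun x => F x + G x) w u (A + B).
Proof.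
move=> dF dG i j; have [r1 i1] := dF i j; have [r2 i2] := dG i j; rewrite mxE cReD cImD.
split; under eq_fun do rewrite mxE ?cReD ?cImD; exact: is_deriveD.
Qed.

Lemma is_derive_cmxN F w u A : is_derive_cmx F w u A ->
  is_derive_cmx (fun x => - F x) w u (- A).
Proof.
move=> dF i j; have [r1 i1] := dF i j; rewrite mxE cReN cImN.
split; under eq_fun do rewrite mxE ?cReN ?cImN; exact: is_deriveN.
Qed.

Lemma is_derive_cmxB F G w u A B : is_derive_cmx F w u A -> is_derive_cmx G w u B ->
  is_derive_cmx (fun x => F x - G x) w u (A - B).
Proof. by move=> dF dG; apply: is_derive_cmxD => //; exact: is_derive_cmxN. Qed.

Lemma is_derive_mul (f h : V -> R) (df dh : R) u w :
  is_derive u w f df -> is_derive u w h dh ->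
  is_derive u w (fun x => f x * h x) (df * h u + f u * dh).
Proof.
move=> Hf Hh; have := @is_deriveM _ _ _ _ _ _ _ _ Hf Hh; rewrite [X in is_derive _ _ _ X](_ : _ = df * h u + f u * dh)//.
by rewrite addrC; congr (_ + _); rewrite [LHS]mulrC.
Qed.

Lemma is_derive_cmxM F G w u A B : is_derive_cmx F w u A -> is_derive_cmx G w u B ->
  is_derive_cmx (fun x => F x *m G x) w u (A *m G u + F u *m B).
Proof.
move=> dF dG i j; split.
- under eq_fun => x do (rewrite mxE cRe_sum; under eq_bigr do rewrite cReM).
  rewrite !mxE cReD !cRe_sum -big_split /=.
  apply: is_derive_big => k; have [r1 i1] := dF i k; have [r2 i2] := dG k j.
  rewrite !cReM addrACA -opprD.
  by apply: is_deriveB; exact: is_derive_mul.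
- under eq_fun => x do (rewrite mxE cIm_sum; under eq_bigr do rewrite cImM).
  rewrite !mxE cImD !cIm_sum -big_split /=.
  apply: is_derive_big => k; have [r1 i1] := dF i k; have [r2 i2] := dG k j.
  rewrite !cImM addrACA.
  by apply: is_deriveD; exact: is_derive_mul.
Qed.

Lemma is_derive_cmx_trmxC F w u A : is_derive_cmx F w u A ->
  is_derive_cmx (fun x => (F x) ^t*) w u (A ^t*).
Proof.
move=> dF i j; have [r1 i1] := dF j i; rewrite !mxE cRe_conj cIm_conj; split.
- by under eq_fun do rewrite !mxE cRe_conj.
- by under eq_fun do rewrite !mxE cIm_conj; exact: is_deriveN.
Qed.

Lemma is_derive_cmxZ f F w u (df : R) A : is_derive u w f df -> is_derive_cmx F w u A ->
  is_derive_cmx (fun x => (f x)%:C *: F x) w u (df%:C *: F u + (f u)%:C *: A).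
Proof.
move=> Hf dF i j; have [r1 i1] := dF i j; rewrite !mxE cReD cImD !cReM !cImM /= !mul0r !subr0 !addr0; split.
- under eq_fun do rewrite mxE cReM /= mul0r subr0; exact: is_derive_mul.
- under eq_fun do rewrite mxE cImM /= mul0r addr0; exact: is_derive_mul.
Qed.

Lemma is_derive_cmxZc (c : R[i]) F w u A : is_derive_cmx F w u A ->
  is_derive_cmx (fun x => c *: F x) w u (c *: A).
Proof.
move=> dF; have := is_derive_cmxM (is_derive_cmx_cst c%:M w u) dF.
rewrite mul0mx add0r mul_scalar_mx; congr is_derive_cmx.
by apply/funext => x; rewrite mul_scalar_mx.
Qed.

Lemma is_derive_g F G w u A B : is_derive_cmx F w u A -> is_derive_cmx G w u B ->
  is_derive u w (fun x => g (F x) (G x)) (g A (G u) + g (F u) B).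
Proof.
move=> dF dG; have := is_derive_cmxM dF (is_derive_cmx_trmxC dG) => dFG.
have tr : is_derive u w (fun x => \sum_i complex.Re ((F x *m (G x) ^t*) i i))
   (\sum_i complex.Re ((A *m (G u) ^t* + F u *m B ^t*) i i)).
  by apply: is_derive_big => i; have [] := dFG i i.
have := is_derive_mul (is_derive_cst (4^-1 : R) u w) tr.
rewrite mul0r add0r -cRe_sum -[X in complex.Re X]/(\tr _) mxtraceD cReD mulrDr.
by under eq_fun do rewrite /= -cRe_sum.
Qed.

Lemma derive_lin f u a w1 w2 : differentiable f u ->
  'D_(a *: w1 + w2) f u = a * 'D_w1 f u + 'D_w2 f u.
Proof.
move=> df; rewrite (deriveE _ df) (deriveE w1 df) (deriveE w2 df).
exact: (linearP ('d f u)).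
Qed.

Lemma derive_cmx_lin F u a w1 w2 : differentiable_cmx F u ->
  Defs.derive_mx F (a *: w1 + w2) u = a%:C *: Defs.derive_mx F w1 u + Defs.derive_mx F w2 u.
Proof.
move=> dF; apply/matrixP => i j; have [d1 d2] := dF i j; rewrite !mxE.
rewrite !derive_lin//; apply/eqP; rewrite eq_complex /=.
by apply/andP; split; apply/eqP; ring.
Qed.

Lemma near_derive_cmx F G u w : (\near u, F u = G u) ->
  Defs.derive_mx F w u = Defs.derive_mx G w u.
Proof.
move=> FG; apply/matrixP => i j; rewrite !derive_mxE; congr Complex; apply: near_eq_derive;
  by apply: filterS FG => x ->.
Qed.

Lemma near_is_derive_cmx F G u w A : (\near u, F u = G u) ->
  is_derive_cmx F w u A -> is_derive_cmx G w u A.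
Proof.
move=> FG dF i j; have [d1 d2] := dF i j.
split; [apply: near_eq_is_derive d1|apply: near_eq_is_derive d2];
  by apply: filterS FG => x ->.
Qed.

Definition smooth_cmx (U : set V) F : Prop := forall i j,
  smooth_on U (fun x => complex.Re (F x i j)) /\ smooth_on U (fun x => complex.Im (F x i j)).

Lemma smooth_cmx_diff U F u : smooth_cmx U F -> U u -> differentiable_cmx F u.
Proof. by move=> sF Uu i j; have [s1 s2] := sF i j; split; exact: smooth_on_diff Uu. Qed.

Lemma smooth_cmx_sub U U' F : U' `<=` U -> smooth_cmx U F -> smooth_cmx U' F.
Proof. by move=> UU' sF i j; have [s1 s2] := sF i j; split; exact: smooth_on_sub UU' _. Qed.

Lemma smooth_cmx_derive U F w : smooth_cmx U F -> smooth_cmx U (Defs.derive_mx F w).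
Proof.
move=> sF i j; have [s1 s2] := sF i j; split.
- by under eq_fun do rewrite derive_mxE /=; exact: smooth_on_derive.
- by under eq_fun do rewrite derive_mxE /=; exact: smooth_on_derive.
Qed.

Lemma eq_smooth_cmx U F G : open U -> (forall u, U u -> F u = G u) ->
  smooth_cmx U F -> smooth_cmx U G.
Proof.
move=> oU FG sF i j; have [s1 s2] := sF i j.
by split; [apply: eq_smooth_on s1|apply: eq_smooth_on s2] => // u Uu; rewrite FG.
Qed.

Lemma smooth_cmx_cst U A : smooth_cmx U (fun=> A).
Proof. by move=> i j; split; exact: smooth_on_cst. Qed.

Lemma smooth_cmxD U F G : open U -> smooth_cmx U F -> smooth_cmx U G ->
  smooth_cmx U (fun x => F x + G x).
Proof.
move=> oU sF sG i j; have [s1 s2] := sF i j; have [t1 t2] := sG i j.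
by split; under eq_fun do rewrite mxE ?cReD ?cImD; exact: smooth_onD.
Qed.

Lemma smooth_cmxM U F G : open U -> smooth_cmx U F -> smooth_cmx U G ->
  smooth_cmx U (fun x => F x *m G x).
Proof.
move=> oU sF sG i j; split.
- under eq_fun => x do (rewrite mxE cRe_sum; under eq_bigr do rewrite cReM).
  apply: smooth_on_sum => // k; have [s1 s2] := sF i k; have [t1 t2] := sG k j.
  by apply: smooth_onB => //; exact: smooth_onM.
- under eq_fun => x do (rewrite mxE cIm_sum; under eq_bigr do rewrite cImM).
  apply: smooth_on_sum => // k; have [s1 s2] := sF i k; have [t1 t2] := sG k j.
  by apply: smooth_onD => //; exact: smooth_onM.
Qed.

Lemma smooth_cmxZc U (c : R[i]) F : open U -> smooth_cmx U F -> smooth_cmx U (fun x => c *: F x).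
Proof.
move=> oU sF; apply: (@eq_smooth_cmx _ (fun x => c%:M *m F x)) => //.
  by move=> u _; rewrite mul_scalar_mx.
by apply: smooth_cmxM => //; exact: smooth_cmx_cst.
Qed.

Lemma smooth_cmxN U F : open U -> smooth_cmx U F -> smooth_cmx U (fun x => - F x).
Proof.
move=> oU sF; apply: (@eq_smooth_cmx _ (fun x => -1 *: F x)) => //.
  by move=> u _; rewrite scaleN1r.
exact: smooth_cmxZc.
Qed.

Lemma smooth_cmxZ U f F : open U -> smooth_on U f -> smooth_cmx U F ->
  smooth_cmx U (fun x => (f x)%:C *: F x).
Proof.
move=> oU sf sF i j; have [s1 s2] := sF i j; split.
- by under eq_fun do rewrite mxE cReM /= mul0r subr0; exact: smooth_onM.
- by under eq_fun do rewrite mxE cImM /= mul0r addr0; exact: smooth_onM.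
Qed.

Lemma smooth_on_g U F G : open U -> smooth_cmx U F -> smooth_cmx U G ->
  smooth_on U (fun x => g (F x) (G x)).
Proof.
move=> oU sF sG.
apply: (eq_smooth_on oU (f := fun x => 4^-1 * \sum_i \sum_j
    (complex.Re (F x i j) * complex.Re (G x i j) + complex.Im (F x i j) * complex.Im (G x i j)))).
  by move=> u _; rewrite gE.
apply: (smooth_onM oU); first exact: smooth_on_cst.
apply: smooth_on_sum => [//|i]; apply: smooth_on_sum => [//|j].
have [s1 s2] := sF i j; have [t1 t2] := sG i j.
by apply: (smooth_onD oU); exact: smooth_onM.
Qed.

Lemma derive_cmx_comm U F u v w : open U -> smooth_cmx U F -> U u ->
  Defs.derive_mx (Defs.derive_mx F v) w u = Defs.derive_mx (Defs.derive_mx F w) v u.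
Proof.
move=> oU sF Uu; apply/matrixP => i j; have [s1 s2] := sF i j.
have ER v' : (fun x => complex.Re (Defs.derive_mx F v' x i j)) = 'D_v' (fun x => complex.Re (F x i j)).
  by apply/funext => x; rewrite derive_mxE.
have EI v' : (fun x => complex.Im (Defs.derive_mx F v' x i j)) = 'D_v' (fun x => complex.Im (F x i j)).
  by apply/funext => x; rewrite derive_mxE.
apply: (etrans (derive_mxE _ _ _ _ _)); apply: (etrans _ (esym (derive_mxE _ _ _ _ _))).
apply: eq_Complex.
  by rewrite (ER v) (ER w); exact: derive_comm oU s1 Uu.
by rewrite (EI v) (EI w); exact: derive_comm oU s2 Uu.
Qed.

End MatrixCalculus.

(** * Geometry of the hypersurface *)

Section Charts.
Context {R : realType} {n : nat} {M : manifold R n}.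
Implicit Types (p q : M) (W : set M).

Lemma open_setI_preimage (S T : topologicalType) (A : set S) (B : set T) (f : S -> T) :
  open A -> open B -> (forall x, A x -> {for x, continuous f}) -> open (A `&` f @^-1` B).
Proof.
move=> oA oB cf; rewrite openE => x [Ax Bfx]; apply: filterI.
  exact: open_nbhs_nbhs.
apply: (cf x Ax); exact: open_nbhs_nbhs.
Qed.

Definition chart_img p : set M := par p @` dom p.
Definition chart_pre p W : set 'rV[R]_n := dom p `&` par p @^-1` W.

Lemma open_chart_pre p W : open W -> open (chart_pre p W).
Proof.
by move=> oW; apply: open_setI_preimage => //; [exact: dom_open|exact: par_continuous].
Qed.

Lemma chart_img_self p : chart_img p p. Proof. exact: img_center. Qed.

Lemma dom_coord p q : chart_img p q -> dom p (coord p q).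
Proof. by case=> u du <-; rewrite parK. Qed.

Lemma coordK p q : chart_img p q -> par p (coord p q) = q.
Proof. by case=> u du <-; rewrite parK. Qed.

Lemma chart_pre_coord p q W : W q -> chart_img p q -> chart_pre p W (coord p q).
Proof. by move=> Wq iq; split; [exact: dom_coord|rewrite /preimage /= coordK]. Qed.

Lemma open_chart_image p (U : set 'rV[R]_n) : open U -> U `<=` dom p -> open (par p @` U).
Proof.
move=> oU Ud.
have -> : par p @` U = chart_img p `&` coord p @^-1` U.
  apply/seteqP; split=> [q [u Uu <-]|q [iq Uq]].
    by split; [exists u => //; exact: Ud|rewrite /preimage /= parK//; exact: Ud].
  by exists (coord p q) => //; exact: coordK.
by apply: open_setI_preimage => //; [exact: img_open|exact: Defs.coord_continuous].
Qed.

Lemma smooth_sub W W' (f : M -> R) : W' `<=` W -> smooth W f -> smooth W' f.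
Proof. by move=> WW sf p; apply: smooth_on_sub (sf p) => u [du /WW]. Qed.

Lemma smooth_local W (f : M -> R) :
  (forall p, W p -> exists W', W' p /\ smooth W' f) -> smooth W f.
Proof.
by move=> sf p s u [du Wu]; have [W' [Wp sf']] := sf _ Wu; exact: sf'.
Qed.

(** Smoothness is required in every chart of the atlas; checking it in one is enough, by composition
    with the transition maps. *)
Lemma smooth_chart p (U : set 'rV[R]_n) (f : M -> R) : open U -> U `<=` dom p ->
  smooth_on U (fun u => f (par p u)) -> smooth (par p @` U) f.
Proof.
move=> oU Ud sf q.
have oV : open (chart_pre q (par p @` U)) by exact/open_chart_pre/open_chart_image.
apply: (@eq_smooth_on _ _ _ (fun u => f (par p (coord p (par q u))))) => //.
  by move=> u [_ [v Uv] <-]; rewrite parK//; exact: Ud.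
apply: (@smooth_on_comp _ _ _ _ U (fun v => f (par p v)) (fun u => coord p (par q u))) => //.
- by move=> u [_ [v Uv] /= <-]; rewrite parK//; exact: Ud.
- move=> i; apply: smooth_on_sub (@transition_smooth _ _ M q p i).
  by move=> u [du [v Uv E]]; split=> //; exists v => //; exact: Ud.
Qed.

Lemma smooth_mxE (k : nat) W (F : M -> cmx R k) : smooth_mx W F <->
  forall p, smooth_cmx (chart_pre p W) (fun u => F (par p u)).
Proof.
split=> [sF p i j|sF i j]; first by have [s1 s2] := sF i j; split; [exact: s1|exact: s2].
by split=> p; have [s1 s2] := sF p i j.
Qed.

Lemma smooth_mx_sub (k : nat) W W' (F : M -> cmx R k) : W' `<=` W -> smooth_mx W F -> smooth_mx W' F.
Proof. by move=> WW sF i j; have [s1 s2] := sF i j; split; exact: smooth_sub WW _. Qed.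

Lemma smooth_mx_chart (k : nat) p (U : set 'rV[R]_n) (F : M -> cmx R k) : open U -> U `<=` dom p ->
  smooth_cmx U (fun u => F (par p u)) -> smooth_mx (par p @` U) F.
Proof. by move=> oU Ud sF i j; have [s1 s2] := sF i j; split; exact: smooth_chart. Qed.

Lemma eq_smooth_mx (k : nat) W (F G : M -> cmx R k) : open W -> (forall p, W p -> F p = G p) ->
  smooth_mx W F -> smooth_mx W G.
Proof.
move=> oW FG /smooth_mxE sF; apply/smooth_mxE => p; apply: eq_smooth_cmx (sF p).
  exact: open_chart_pre.
by move=> u [_ Wu]; exact: FG.
Qed.

Definition transition p q (u : 'rV[R]_n) : 'rV[R]_n := coord q (par p u).

(** The differential at the point [q] of the change from the chart of index [p] to the chart of
    index [q], applied to [w]. *)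
Definition transition_derive p q (w : 'rV[R]_n) : 'rV[R]_n :=
  \row_i 'D_w (fun u => transition p q u ord0 i) (coord p q).

Lemma near_chart p q W : open W -> W q -> chart_img p q ->
  \forall u \near coord p q, chart_pre p W u.
Proof.
move=> oW Wq iq; apply: open_nbhs_nbhs; split; first exact: open_chart_pre.
exact: chart_pre_coord.
Qed.

(** [dir] and [dir_mx] read a derivative at [q] in the chart of index [q], so any identity to be
    differentiated again in one fixed chart must first be transported by this chain rule. *)
Lemma derive_transition p q (f : M -> R) w : chart_img p q ->
  differentiable (fun v => f (par q v)) (coord q q) ->
  'D_w (fun u => f (par p u)) (coord p q) =
  'D_(transition_derive p q w) (fun v => f (par q v)) (coord q q).
Proof.
move=> iq df.
have iqq : chart_img q q by exact: chart_img_self.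
have oi : open (chart_img q) by exact: img_open.
have dt i : differentiable (fun u => transition p q u ord0 i) (coord p q).
  have := @transition_smooth _ _ M p q i => st.
  exact: (smooth_on_diff st (chart_pre_coord iqq iq)).
have E : \forall u \near coord p q, f (par p u) = f (par q (transition p q u)).
  apply: filterS (near_chart oi iqq iq) => u [_ iu]; by rewrite /transition coordK.
have tq : transition p q (coord p q) = coord q q by rewrite /transition coordK.
rewrite (near_eq_derive _ E) (@derive_comp_row _ _ _ (fun v => f (par q v)) (transition p q)) ?tq//.
rewrite [RHS]deriveE// [X in 'd _ _ X]row_sum_delta linear_sum; apply: eq_bigr => i _.
by rewrite linearZ -deriveE// mxE.
Qed.

End Charts.

(** * Coordinate fields, tangent spaces and frames of the hypersurface *)

Section Hypersurface.
Context {R : realType} {m : nat} {M : hypersurface R m}.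
Notation n := (4 * m - 1)%N.
Implicit Types (p q : M) (W : set M) (X Y Z : M -> cmx R m) (w : 'rV[R]_n).

Lemma imm_smooth_chart p : smooth_cmx (dom p) (fun u => imm (par p u)).
Proof.
have /smooth_mxE/(_ p) := imm_smooth M.
by apply: smooth_cmx_sub => u du; split.
Qed.

Lemma imm_differentiable p u : dom p u -> differentiable_cmx (fun u => imm (par p u)) u.
Proof. by move=> du; exact: smooth_cmx_diff (imm_smooth_chart p) du. Qed.

Lemma coord_field_par p w u : dom p u ->
  coord_field p w (par p u) = Defs.derive_mx (fun u => imm (par p u)) w u.
Proof. by move=> du; rewrite /coord_field parK. Qed.

Lemma coord_field_lin p q (a : R) w1 w2 : chart_img p q ->
  coord_field p (a *: w1 + w2) q = a%:C *: coord_field p w1 q + coord_field p w2 q.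
Proof. by move=> iq; apply: derive_cmx_lin; apply: imm_differentiable; exact: dom_coord. Qed.

Lemma coord_field0 p q : chart_img p q -> coord_field p 0 q = 0.
Proof.
move=> iq; have := coord_field_lin (-1) 0 0 iq.
by rewrite scaler0 addr0 rmorphN1 scaleN1r addNr.
Qed.

Lemma coord_fieldD p q w1 w2 : chart_img p q ->
  coord_field p (w1 + w2) q = coord_field p w1 q + coord_field p w2 q.
Proof. by move=> iq; have := coord_field_lin 1 w1 w2 iq; rewrite !scale1r. Qed.

Lemma coord_fieldZ p q a w : chart_img p q ->
  coord_field p (a *: w) q = a%:C *: coord_field p w q.
Proof.
by move=> iq; have := coord_field_lin a w 0 iq; rewrite !addr0 coord_field0// addr0.
Qed.

Lemma coord_field_sum p q w : chart_img p q ->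
  coord_field p w q = \sum_i (w ord0 i)%:C *: coord_field p (delta_mx ord0 i) q.
Proof.
move=> iq; rewrite {1}[w]row_sum_delta.
elim/big_ind2: _ => [|a b c d E1 E2|i _]; first exact: coord_field0.
  by rewrite coord_fieldD// E1 E2.
exact: coord_fieldZ.
Qed.

Lemma coord_field_inj p w1 w2 : coord_field p w1 p = coord_field p w2 p -> w1 = w2.
Proof.
move=> E; apply/eqP; rewrite -subr_eq0; apply/eqP; apply: (@imm_immersion _ _ _ p).
have := coord_field_lin (-1) w2 w1 (chart_img_self p).
by rewrite scaleN1r rmorphN1 scaleN1r E addNr addrC.
Qed.

Lemma components_coord_field p w : components p (coord_field p w p) = w.
Proof.
rewrite /components; have := @xgetPex _ 0 [set w' | coord_field p w p = coord_field p w' p].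
by move=> /(_ (ex_intro _ w erefl)) /= /esym; exact: coord_field_inj.
Qed.

Lemma coord_field_components p v : tangent p v -> coord_field p (components p v) p = v.
Proof. by move=> [w ->]; rewrite components_coord_field. Qed.

Lemma tangent_coord_self p w : tangent p (coord_field p w p). Proof. by exists w. Qed.

Lemma tangent0 p : tangent p 0.
Proof. by exists 0; rewrite coord_field0//; exact: chart_img_self. Qed.

Lemma tangentD p v v' : tangent p v -> tangent p v' -> tangent p (v + v').
Proof.
by move=> [w ->] [w' ->]; exists (w + w'); rewrite coord_fieldD//; exact: chart_img_self.
Qed.

Lemma tangentZ p a v : tangent p v -> tangent p (a%:C *: v).
Proof. by move=> [w ->]; exists (a *: w); rewrite coord_fieldZ//; exact: chart_img_self. Qed.

Lemma tangentN p v : tangent p v -> tangent p (- v).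
Proof. by move=> /(@tangentZ _ (-1)); rewrite rmorphN1 scaleN1r. Qed.

Lemma tangentB p v v' : tangent p v -> tangent p v' -> tangent p (v - v').
Proof. by move=> tv tv'; apply: tangentD => //; exact: tangentN. Qed.

Lemma tangent_sum p (I : Type) (r : seq I) (Q : pred I) (f : I -> cmx R m) :
  (forall i, tangent p (f i)) -> tangent p (\sum_(i <- r | Q i) f i).
Proof.
by move=> tf; elim/big_ind: _ => //; [exact: tangent0|move=> v v'; exact: tangentD].
Qed.

Lemma derive_imm_gr_tangent p w u : dom p u ->
  gr_tangent (imm (par p u)) (Defs.derive_mx (fun u => imm (par p u)) w u).
Proof.
move=> du; have dF := differentiable_is_derive w (imm_differentiable du).
have Et : (fun x => (imm (par p x)) ^t*) = (fun x => imm (par p x)).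
  by apply/funext => x; have [] := imm_grassmannian (par p x).
have EM : (fun x => imm (par p x) *m imm (par p x)) = (fun x => imm (par p x)).
  by apply/funext => x; have [] := imm_grassmannian (par p x).
have tF := is_derive_cmxP (is_derive_cmx_trmxC dF); rewrite Et in tF.
have MF := is_derive_cmxP (is_derive_cmxM dF dF); rewrite EM in MF.
by split.
Qed.

Lemma coord_field_gr_tangent p q w : chart_img p q -> gr_tangent (imm q) (coord_field p w q).
Proof.
by move=> iq; have := derive_imm_gr_tangent w (dom_coord iq); rewrite coordK.
Qed.

Lemma tangent_gr_tangent p v : tangent p v -> gr_tangent (imm p) v.
Proof. by move=> [w ->]; apply: coord_field_gr_tangent; exact: chart_img_self. Qed.

Lemma smooth_mx_differentiable W Y p q : open W -> smooth_mx W Y -> W q -> chart_img p q ->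
  differentiable_cmx (fun u => Y (par p u)) (coord p q).
Proof.
move=> oW /smooth_mxE sY Wq iq; apply: smooth_cmx_diff (sY p) _.
exact: chart_pre_coord.
Qed.

Lemma derive_mx_transition W Y p q w : open W -> smooth_mx W Y -> W q -> chart_img p q ->
  Defs.derive_mx (fun u => Y (par p u)) w (coord p q) =
  Defs.derive_mx (fun u => Y (par q u)) (transition_derive p q w) (coord q q).
Proof.
move=> oW sY Wq iq; have dY := smooth_mx_differentiable oW sY Wq (chart_img_self q).
apply/matrixP => i j; have [d1 d2] := dY i j.
apply: (etrans (derive_mxE _ _ _ _ _)); apply: (etrans _ (esym (derive_mxE _ _ _ _ _))).
apply: eq_Complex.
  exact: (derive_transition (f := fun r => complex.Re (Y r i j)) w iq d1).
exact: (derive_transition (f := fun r => complex.Im (Y r i j)) w iq d2).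
Qed.

Lemma coord_field_transition p q w : chart_img p q ->
  coord_field p w q = coord_field q (transition_derive p q w) q.
Proof.
by move=> iq; exact: derive_mx_transition openT (imm_smooth M) I iq.
Qed.

Lemma tangent_coord_field p q w : chart_img p q -> tangent q (coord_field p w q).
Proof. by move=> iq; rewrite coord_field_transition//; exact: tangent_coord_self. Qed.

Lemma dir_mx_coord_field W Y p q w : open W -> smooth_mx W Y -> W q -> chart_img p q ->
  dir_mx Y q (coord_field p w q) = Defs.derive_mx (fun u => Y (par p u)) w (coord p q).
Proof.
move=> oW sY Wq iq; rewrite coord_field_transition// /dir_mx components_coord_field.
by rewrite -(derive_mx_transition w oW sY Wq iq).
Qed.

Lemma smooth_coord_field p w : smooth_mx (chart_img p) (coord_field p w).
Proof.
apply: smooth_mx_chart; [exact: dom_open|by []|].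
apply: eq_smooth_cmx (smooth_cmx_derive w (imm_smooth_chart p)); first exact: dom_open.
by move=> u du; rewrite coord_field_par.
Qed.

Lemma vector_field_coord p w : vector_field (chart_img p) (coord_field p w).
Proof. by split; [exact: smooth_coord_field|move=> q iq; exact: tangent_coord_field]. Qed.

Lemma vector_field_sub W W' X : W' `<=` W -> vector_field W X -> vector_field W' X.
Proof. by move=> WW [sX tX]; split; [exact: smooth_mx_sub WW _|move=> p /WW /tX]. Qed.

(** Vectors are added one at a time: fewer than n linear conditions on n components have a nonzero
    solution, which is orthogonal to the previous vectors and is then normalized. *)
Lemma orthonormal_tangents p k : (k <= n)%N -> exists e : 'I_k -> cmx R m,
  (forall i, tangent p (e i)) /\ (forall i j, g (e i) (e j) = (i == j)%:R).
Proof.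
elim: k => [|k IH] kn; first by exists (fun=> 0); split; case.
have [e [te oe]] := IH (ltnW kn).
pose A : 'M[R]_(n, k) := \matrix_(i, j) g (coord_field p (delta_mx ord0 i) p) (e j).
have ker0 : kermx A != 0.
  rewrite -mxrank_eq0 mxrank_ker subn_eq0 -ltnNge.
  by apply: leq_ltn_trans kn; exact: rank_leq_col.
pose w := nz_row (kermx A).
have w0 : w != 0 by rewrite nz_row_eq0.
have wA : w *m A = 0 by apply/sub_kermxP; exact: nz_row_sub.
have ip := chart_img_self p.
have vE := coord_field_sum w ip.
set v := coord_field p w p in vE.
have ve j : g v (e j) = 0.
  rewrite vE g_suml; have := congr1 (fun B : 'M[R]_(1, k) => B ord0 j) wA.
  rewrite /= !mxE => E; rewrite -[RHS]E.
  by apply: eq_bigr => i _; rewrite gZl mxE.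
have v0 : g v v != 0.
  apply: contraNneq w0 => /g_eq0 v0; apply/eqP; apply: (@coord_field_inj p).
  by rewrite coord_field0.
have vpos : 0 < g v v by rewrite lt0r v0 g_ge0.
pose z := ((Num.sqrt (g v v))^-1)%:C *: v.
have zz : g z z = 1.
  rewrite gZl gZr mulrA -invfM -expr2 sqr_sqrtr ?g_ge0//.
  by rewrite mulVf.
have ze j : g z (e j) = 0 by rewrite gZl ve mulr0.
exists (fun i => if unlift ord0 i is Some j then e j else z); split.
  by move=> i; case: unliftP => [j _|_] //; apply: tangentZ; exact: tangent_coord_self.
move=> i j; case: unliftP => [i' ->|->]; case: unliftP => [j' ->|->].
- by rewrite oe (inj_eq lift_inj).
- by rewrite gC ze eq_sym (negbTE (neq_lift _ _)).
- by rewrite ze (negbTE (neq_lift _ _)).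
- by rewrite zz eqxx.
Qed.

Lemma frameP p : (forall i, tangent p (frame p i)) /\
  (forall i j, g (frame p i) (frame p j) = (i == j)%:R).
Proof.
have [e oe] := orthonormal_tangents p (leqnn n).
exact: (@xgetPex _ (fun=> 0) [set e | (forall i, tangent p (e i)) /\
                          (forall i j, g (e i) (e j) = (i == j)%:R)] (ex_intro _ e oe)).
Qed.

End Hypersurface.

(** * The Levi-Civita connection as the tangential part of the ambient derivative *)

Lemma skew_arith (R : realDomainType) (x y z u : R) : x + y = z + u -> z - x = - (u - y).
Proof. by move=> E; lra. Qed.

(** The values at the six orders of the arguments of a form skew in one pair of adjacent places and
    symmetric in the other: going round the cycle changes the sign three times. *)
Lemma braid_arith (R : realDomainType) (x1 x2 x3 x4 x5 x6 : R) : x1 = - x2 -> x2 = x3 ->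
  x3 = - x4 -> x4 = x5 -> x5 = - x6 -> x6 = x1 -> x1 = 0.
Proof. by lra. Qed.

Lemma sum_arith (R : realDomainType) (x y z u : R) : 0 = x - y + z -> u = z -> y = x + u.
Proof. by lra. Qed.

Section LeviCivita.
Context {R : realType} {m : nat} {M : hypersurface R m}.
Notation n := (4 * m - 1)%N.
Implicit Types (p q : M) (W : set M) (X Y Z : M -> cmx R m) (a b c d w : 'rV[R]_n).

Lemma derive_dir_g W Y Z p v : open W -> smooth_mx W Y -> smooth_mx W Z -> W p ->
  dir (fun q => g (Y q) (Z q)) p v = g (dir_mx Y p v) (Z p) + g (Y p) (dir_mx Z p v).
Proof.
move=> oW sY sZ Wp; have ip := chart_img_self p.
have dY := differentiable_is_derive (components p v) (smooth_mx_differentiable oW sY Wp ip).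
have dZ := differentiable_is_derive (components p v) (smooth_mx_differentiable oW sZ Wp ip).
have [_ E] := is_derive_g dY dZ; apply: etrans E _.
by rewrite coordK.
Qed.

Lemma dir_mx0 Y p : dir_mx Y p 0 = 0.
Proof.
have -> : (0 : cmx R m) = coord_field p 0 p by rewrite coord_field0//; exact: chart_img_self.
rewrite /dir_mx components_coord_field.
apply/matrixP => i j; apply: (etrans (derive_mxE _ _ _ _ _)).
by rewrite mxE !derive0.
Qed.

Variable nabla : (M -> cmx R m) -> (M -> cmx R m) -> M -> cmx R m.
Hypothesis nabla_LC : levi_civita nabla.

Lemma nabla_vector_field W X Y : open W -> vector_field W X -> vector_field W Y ->
  vector_field W (nabla X Y).
Proof.
move=> oW vX vY; have [cn _ _] := nabla_LC.
have s1 : smooth W (fun=> 1 : R) by move=> p; exact: smooth_on_cst.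
by have [] := cn W X Y X _ oW vX vY vX s1.
Qed.

(* Koszul's argument: the difference between nabla X Y and the derivative of Y
   along X is symmetric in X, Y by torsion-freeness and skew in its last two
   arguments by metricity, hence zero against tangent vectors. *)
Lemma levi_civita_tangential W X Y p v : open W -> vector_field W X -> vector_field W Y ->
  W p -> tangent p v -> g (nabla X Y p) v = g (dir_mx Y p (X p)) v.
Proof.
move=> oW vX vY Wp tv; have ip := chart_img_self p.
pose W' := W `&` chart_img p.
have oW' : open W' by apply: openI => //; exact: img_open.
have Wp' : W' p by split.
have vX' : vector_field W' X by apply: vector_field_sub vX => q [].
have vY' : vector_field W' Y by apply: vector_field_sub vY => q [].
pose Z := coord_field p (components p v).
have vZ : vector_field W' Z by apply: vector_field_sub (vector_field_coord p _) => q [].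
have Zp : Z p = v by exact: coord_field_components.
have [_ metric torsion] := nabla_LC.
pose t A B C := g (nabla A B p - dir_mx B p (A p)) (C p).
have skew A B C : vector_field W' A -> vector_field W' B -> vector_field W' C ->
    t A B C = - t A C B.
  move=> vA vB vC; have := metric W' A B C oW' vA vB vC p Wp'.
  rewrite (derive_dir_g (A p) oW' vB.1 vC.1 Wp').
  rewrite /t !gBl (gC (nabla A C p)) (gC (dir_mx C p (A p))).
  exact: skew_arith.
have sym A B C : vector_field W' A -> vector_field W' B -> vector_field W' C ->
    t A B C = t B A C.
  move=> vA vB vC; have E := torsion W' A B oW' vA vB p Wp'.
  apply/eqP; rewrite -subr_eq0 -gBl; apply/eqP.
  have -> : nabla A B p - dir_mx B p (A p) - (nabla B A p - dir_mx A p (B p)) =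
      (nabla A B p - nabla B A p) - bracket A B p.
    rewrite /bracket; move: (nabla A B p) (nabla B A p) (dir_mx B p (A p)) (dir_mx A p (B p)).
    by move=> x y z u; mx_ring.
  by rewrite E subrr g0l.
have t0 : t X Y Z = 0.
  have e1 := skew X Y Z vX' vY' vZ; have e2 := sym X Z Y vX' vZ vY'.
  have e3 := skew Z X Y vZ vX' vY'; have e4 := sym Z Y X vZ vY' vX'.
  have e5 := skew Y Z X vY' vZ vX'; have e6 := sym Y X Z vY' vX' vZ.
  exact: braid_arith e1 e2 e3 e4 e5 e6.
by move: t0; rewrite /t gBl Zp => /eqP; rewrite subr_eq0 => /eqP.
Qed.

Lemma tangent_eq p v v' : tangent p v -> tangent p v' ->
  (forall u, tangent p u -> g v u = g v' u) -> v = v'.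
Proof.
move=> tv tv' E; apply/eqP; rewrite -subr_eq0; apply/eqP/g_eq0.
have td := tangentB tv tv'.
by rewrite {1}gBl E// subrr.
Qed.

Definition second_derivative p a b : cmx R m :=
  Defs.derive_mx (Defs.derive_mx (fun u => imm (par p u)) b) a (coord p p).

(** The second fundamental form of [M] in the flat space of matrices, on coordinate fields; its
    normality is [normal_part_tangent]. *)
Definition normal_part p a b : cmx R m :=
  second_derivative p a b - nabla (coord_field p a) (coord_field p b) p.

Let F p := fun u => imm (par p u).

Lemma dir_mx_coord_coord p a b u : dom p u ->
  dir_mx (coord_field p b) (par p u) (coord_field p a (par p u)) =
  Defs.derive_mx (Defs.derive_mx (F p) b) a u.
Proof.
move=> du; have iu : chart_img p (par p u) by exists u.
apply: (etrans (dir_mx_coord_field a (img_open p) (smooth_coord_field p b) iu iu)).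
rewrite (parK du).
have E : \forall x \near u, coord_field p b (par p x) = Defs.derive_mx (F p) b x.
  have : \forall x \near u, dom p x by apply: open_nbhs_nbhs; split => //; exact: dom_open.
  by apply: filterS => x dx; exact: coord_field_par.
exact: near_derive_cmx E.
Qed.

(** This holds on the whole chart domain, not just at its centre, because
    [second_covariant_derivative] differentiates the identity. *)
Lemma normal_part_normal p a b u d : dom p u ->
  g (Defs.derive_mx (Defs.derive_mx (F p) b) a u -
     nabla (coord_field p a) (coord_field p b) (par p u)) (Defs.derive_mx (F p) d u) = 0.
Proof.
move=> du; have iu : chart_img p (par p u) by exists u.
rewrite gBl -dir_mx_coord_coord// -coord_field_par//.
rewrite (levi_civita_tangential (img_open p) (vector_field_coord p a) (vector_field_coord p b) iu) ?subrr//.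
exact: tangent_coord_field.
Qed.

Lemma nabla_coord_tangent p a b : tangent p (nabla (coord_field p a) (coord_field p b) p).
Proof.
have [_] := nabla_vector_field (img_open p) (vector_field_coord p a) (vector_field_coord p b).
by apply; exact: chart_img_self.
Qed.

Lemma normal_part_tangent p a b v : tangent p v -> g (normal_part p a b) v = 0.
Proof.
move=> [d ->]; have ip := chart_img_self p.
have := normal_part_normal a b d (dom_coord ip).
by rewrite coordK.
Qed.

(* Obtained by differentiating the orthogonality of the normal part to the
   coordinate field d; this avoids differentiating the normal part itself. *)
Lemma second_covariant_derivative p a b c d :
  g (nabla (coord_field p a) (nabla (coord_field p b) (coord_field p c)) p) (coord_field p d p) =
  g (Defs.derive_mx (Defs.derive_mx (Defs.derive_mx (F p) c) b) a (coord p p)) (coord_field p d p)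
  + g (normal_part p b c) (normal_part p a d).
Proof.
have ip := chart_img_self p; have du := dom_coord ip.
have va := vector_field_coord p a; have vb := vector_field_coord p b.
have vc := vector_field_coord p c; have oi := img_open p.
have vV := nabla_vector_field oi vb vc; set V := nabla _ (coord_field p c) in vV *.
have tp := tangent_coord_self p d.
rewrite (levi_civita_tangential oi va vV ip tp) (dir_mx_coord_field a oi vV.1 ip ip).
have sF := imm_smooth_chart p.
have dV := differentiable_is_derive a (smooth_mx_differentiable oi vV.1 ip ip).
have dD := differentiable_is_derive a
  (smooth_cmx_diff (smooth_cmx_derive b (smooth_cmx_derive c sF)) du).
have dd := differentiable_is_derive a (smooth_cmx_diff (smooth_cmx_derive d sF) du).
have [_] := is_derive_g (is_derive_cmxB dD dV) dd.
have nz : \forall u \near coord p p, g (Defs.derive_mx (Defs.derive_mx (F p) c) b u - V (par p u))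
    (Defs.derive_mx (F p) d u) = (cst 0 : 'rV[R]_n -> R) u.
  have : \forall u \near coord p p, dom p u.
    by apply: open_nbhs_nbhs; split => //; exact: dom_open.
  by apply: filterS => u; exact: normal_part_normal.
rewrite (near_eq_derive _ nz) derive_cst gBl => E.
apply: (sum_arith E).
rewrite -[X in _ = g (_ - V X) _]/(par p (coord p p)) (coordK ip).
have -> : normal_part p a d = second_derivative p a d - nabla (coord_field p a) (coord_field p d) p.
  by [].
by rewrite gBr (normal_part_tangent _ _ (nabla_coord_tangent p a d)) subr0.
Qed.

End LeviCivita.

(** * Orthogonal projections, the Gauss equation and the Weingarten formula *)

Section OrthogonalProjection.
Context {R : realType} {m : nat}.
Implicit Types (T : set (cmx R m)) (v w : cmx R m).

Lemma oproj_unique T v w : (forall x y, T x -> T y -> T (x - y)) ->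
  T w -> (forall z, T z -> g (v - w) z = 0) -> oproj T v = w.
Proof.
move=> TB Tw vw; rewrite /oproj; set S := [set _ | _].
have [Tx vx] : S (xget 0 S) by apply: xgetPex; exists w; split.
apply/eqP; rewrite -subr_eq0; apply/eqP/g_eq0; have Td := TB _ _ Tx Tw.
rewrite {1}(_ : xget 0 S - w = (v - w) - (v - xget 0 S)); last by move: (xget 0 S) => x; mx_ring.
by rewrite gBl vw// vx// subrr.
Qed.

Lemma oproj_gr_tangent (P v : cmx R m) : grassmannian2 P -> oproj (gr_tangent P) v = gr_proj P v.
Proof.
move=> gP; apply: oproj_unique; first by move=> x y tx ty; apply: gr_tangentD => //; exact: gr_tangentN.
  exact: gr_proj_tangent.
by move=> z tz; rewrite gBl g_gr_proj// subrr.
Qed.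

End OrthogonalProjection.

Lemma gauss_arith (R : realDomainType) (x y z s t u v : R) :
  x = s + u -> y = t + v -> z = 0 -> s = t -> x - y - z = u - v.
Proof. by move=> -> -> -> ->; ring. Qed.

Section Gauss.
Context {R : realType} {m : nat} {M : hypersurface R m}.
Notation n := (4 * m - 1)%N.
Implicit Types (p q : M) (a b c d w : 'rV[R]_n) (x y z v : cmx R m).

Lemma oproj_tangent p x v : tangent p x -> (forall z, tangent p z -> g (v - x) z = 0) ->
  oproj (tangent p) v = x.
Proof. by move=> tx vx; apply: oproj_unique => //; exact: tangentB. Qed.

Variable nabla : (M -> cmx R m) -> (M -> cmx R m) -> M -> cmx R m.
Hypothesis nabla_LC : levi_civita nabla.

Lemma bracket_coord p a b q : chart_img p q ->
  bracket (coord_field p a) (coord_field p b) q = 0.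
Proof.
move=> [u du <-]; rewrite /bracket !dir_mx_coord_coord//.
by rewrite (derive_cmx_comm b a (@dom_open _ _ M p) (imm_smooth_chart p) du) subrr.
Qed.

Lemma vector_field_bracket_coord p a b :
  vector_field (chart_img p) (bracket (coord_field p a) (coord_field p b)).
Proof.
split.
  apply: (@eq_smooth_mx _ _ _ _ _ (fun=> 0)) => [|q iq|]; first exact: img_open.
    by rewrite bracket_coord.
  by apply/smooth_mxE => q; exact: smooth_cmx_cst.
by move=> q iq; rewrite bracket_coord//; exact: tangent0.
Qed.

Lemma riemann_tangent p x y z : tangent p (riemann nabla p x y z).
Proof.
have ip := chart_img_self p; have oi := img_open p.
have vf w := vector_field_coord p w.
have vn X Y := @nabla_vector_field _ _ _ _ nabla_LC (chart_img p) X Y oi.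
have tn X Y : vector_field (chart_img p) X -> vector_field (chart_img p) Y ->
    tangent p (nabla X Y p) by move=> vX vY; exact: (vn X Y vX vY).2.
apply: tangentB; last by apply: tn => //; exact: vector_field_bracket_coord.
by apply: tangentB; apply: tn => //; exact: vn.
Qed.

(** The third derivatives of the immersion cancel by symmetry and the bracket of coordinate fields
    is zero, so only products of normal parts remain: the ambient space is flat. *)
Lemma gauss_equation p a b c d :
  g (riemann nabla p (coord_field p a p) (coord_field p b p) (coord_field p c p)) (coord_field p d p) =
  g (normal_part nabla p b c) (normal_part nabla p a d) -
  g (normal_part nabla p a c) (normal_part nabla p b d).
Proof.
have ip := chart_img_self p; have oi := img_open p.
have -> : riemann nabla p (coord_field p a p) (coord_field p b p) (coord_field p c p) =
    curvature nabla (coord_field p a) (coord_field p b) (coord_field p c) p.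
  by rewrite /riemann !components_coord_field.
have E1 := second_covariant_derivative nabla_LC p a b c d.
have E2 := second_covariant_derivative nabla_LC p b a c d.
have E3 : g (nabla (bracket (coord_field p a) (coord_field p b)) (coord_field p c) p)
    (coord_field p d p) = 0.
  rewrite (levi_civita_tangential nabla_LC oi (vector_field_bracket_coord p a b)
    (vector_field_coord p c) ip (tangent_coord_self p d)).
  by rewrite bracket_coord// dir_mx0 g0l.
have E4 := derive_cmx_comm b a (@dom_open _ _ M p)
  (smooth_cmx_derive c (imm_smooth_chart p)) (dom_coord ip).
have {}E4 := congr1 (fun X => g X (coord_field p d p)) E4.
rewrite /curvature gBl gBl.
apply: (gauss_arith E1 E2 E3).
exact: E4.
Qed.

Variables (W : set M) (N : M -> cmx R m).
Hypotheses (W_open : open W) (N_normal : unit_normal W N) (m_ge3 : (3 <= m)%N).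

Let normal_gr p : W p -> gr_tangent (imm p) (N p). Proof. by move=> /N_normal.2 []. Qed.
Let normal_unit p : W p -> g (N p) (N p) = 1. Proof. by move=> /N_normal.2 []. Qed.
Let normal_orth p v : W p -> tangent p v -> g (N p) v = 0.
Proof. by move=> /N_normal.2 [_ _]; exact. Qed.

(** The subtraction in [4 * m - 1] is truncated, so positivity of [m] enters here. *)
Lemma dimE : n.+1 = (4 * m)%N. Proof. by clear -m_ge3; lia. Qed.

Lemma frame_expand p x : W p -> gr_tangent (imm p) x ->
  x = (g x (N p))%:C *: N p + \sum_i (g x (frame p i))%:C *: frame p i.
Proof.
move=> Wp tx; have [te oe] := frameP p.
apply: (normal_frame_expand (imm_grassmannian p) (normal_gr Wp) (normal_unit Wp) _ _ oe dimE tx).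
  by move=> i; exact/tangent_gr_tangent/te.
by move=> i; exact/normal_orth/te.
Qed.

Lemma tangent_of_orthogonal p x : W p -> gr_tangent (imm p) x -> g x (N p) = 0 -> tangent p x.
Proof.
move=> Wp tx xN; rewrite (frame_expand Wp tx) xN scale0r add0r.
by apply: tangent_sum => i; apply: tangentZ; exact: (frameP p).1.
Qed.

Lemma tangent_expand p x : W p -> tangent p x -> x = \sum_i (g x (frame p i))%:C *: frame p i.
Proof.
move=> Wp tx; have xN : g x (N p) = 0 by rewrite gC normal_orth.
by rewrite {1}(frame_expand Wp (tangent_gr_tangent tx)) xN scale0r add0r.
Qed.

Lemma shape_operatorE p v : shape_operator N p v = - gr_proj (imm p) (dir_mx N p v).
Proof. by rewrite /shape_operator oproj_gr_tangent//; exact: imm_grassmannian. Qed.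

Lemma g_shape_operator p v x : gr_tangent (imm p) x ->
  g (shape_operator N p v) x = - g (dir_mx N p v) x.
Proof. by move=> tx; rewrite shape_operatorE gNl g_gr_proj//; exact: imm_grassmannian. Qed.

(** Differentiate along [a] the orthogonality of the coordinate field [b] to [N]. *)
Lemma second_derivative_normal p a b : W p ->
  g (second_derivative p a b) (N p) = g (coord_field p b p) (shape_operator N p (coord_field p a p)).
Proof.
move=> Wp; have ip := chart_img_self p.
have dD := differentiable_is_derive a
  (smooth_cmx_diff (smooth_cmx_derive b (imm_smooth_chart p)) (dom_coord ip)).
have dN := differentiable_is_derive a (smooth_mx_differentiable W_open N_normal.1 Wp ip).
have [_] := is_derive_g dD dN.
have nz : \forall u \near coord p p, g (Defs.derive_mx (fun u => imm (par p u)) b u) (N (par p u))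
    = (cst 0 : 'rV[R]_n -> R) u.
  apply: filterS (near_chart W_open Wp ip) => u [du Wu].
  by rewrite gC -coord_field_par// normal_orth//; apply: tangent_coord_field; exists u.
rewrite (near_eq_derive _ nz) derive_cst (coordK ip) => /esym/eqP; rewrite addr_eq0 => /eqP E.
apply: etrans E _; rewrite (gC (coord_field p b p)) g_shape_operator; last first.
  exact: coord_field_gr_tangent.
by rewrite (dir_mx_coord_field a W_open N_normal.1 Wp ip) gC.
Qed.

Lemma second_derivative_decompose p a b :
  second_derivative p a b = gr_proj (imm p) (second_derivative p a b) +
    gr_second_form (imm p) (coord_field p a p) (coord_field p b p).
Proof.
have ip := chart_img_self p; have du := dom_coord ip.
pose F := fun u => imm (par p u).
have sF := imm_smooth_chart p.
have dD := differentiable_is_derive a (smooth_cmx_diff (smooth_cmx_derive b sF) du).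
have dF := differentiable_is_derive a (smooth_cmx_diff sF du).
have nd : \forall u \near coord p p, dom p u.
  by apply: open_nbhs_nbhs; split => //; exact: dom_open.
have ta := coord_field_gr_tangent a ip; have tb := coord_field_gr_tangent b ip.
rewrite [X in _ = _ + X]/gr_second_form addrC addrC (addrC (coord_field p a p *m _)).
apply: gr_decompose.
- exact: imm_grassmannian.
- have nt : \forall u \near coord p p, (Defs.derive_mx F b u) ^t* = Defs.derive_mx F b u.
    by apply: filterS nd => u du'; have [] := derive_imm_gr_tangent b du'.
  exact: esym (is_derive_cmxP (near_is_derive_cmx nt (is_derive_cmx_trmxC dD))).
- have ne : \forall u \near coord p p, Defs.derive_mx F b u *m F u + F u *m Defs.derive_mx F b u =
      Defs.derive_mx F b u.
    by apply: filterS nd => u du'; have [] := derive_imm_gr_tangent b du'.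
  have := is_derive_cmxP (near_is_derive_cmx ne
    (is_derive_cmxD (is_derive_cmxM dD dF) (is_derive_cmxM dF dD))).
  rewrite (coordK ip) => E; apply: esym; apply: (etrans E).
  by rewrite -!addrA.
- by apply: sym_prod_comm.
Qed.

Lemma normal_partE p a b : W p -> normal_part nabla p a b =
  (g (coord_field p b p) (shape_operator N p (coord_field p a p)))%:C *: N p +
  gr_second_form (imm p) (coord_field p a p) (coord_field p b p).
Proof.
move=> Wp; have ip := chart_img_self p; have gP := imm_grassmannian p.
set D := second_derivative p a b; set V := nabla (coord_field p a) (coord_field p b) p.
have tV : tangent p V by exact: nabla_coord_tangent.
have DV v : tangent p v -> g D v = g V v.
  move=> tv; have := normal_part_tangent nabla_LC a b tv.
  by rewrite /normal_part gBl => /eqP; rewrite subr_eq0 => /eqP.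
have tD := gr_proj_tangent D gP.
(* Along [M] the second derivative has the component [V]; the only other direction tangent to the
   Grassmannian is [N]. *)
have pD : gr_proj (imm p) D = (g D (N p))%:C *: N p + V.
  rewrite {1}(frame_expand Wp tD) g_gr_proj//; last exact: normal_gr.
  congr (_ + _); rewrite [RHS](tangent_expand Wp tV); apply: eq_bigr => i _.
  have ti := (frameP p).1 i.
  by rewrite g_gr_proj ?DV//; exact: tangent_gr_tangent.
rewrite /normal_part -/D -/V {1}/D second_derivative_decompose -/D pD second_derivative_normal//.
by rewrite addrAC addrK.
Qed.

End Gauss.

(** * The Kaehler structure *)

Section KahlerStructure.
Context {R : realType} {m : nat}.
Implicit Types P X Y Z K : cmx R m.

Lemma trmxC_iZ X : ('i%C *: X) ^t* = - ('i%C *: X ^t*).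
Proof.
rewrite trmxCZ -scaleNr; congr (_ *: _).
by apply/eqP; rewrite conjCE eq_complex /= oppr0 !eqxx.
Qed.

Lemma kahlerJ_tangent P X : grassmannian2 P -> gr_tangent P X -> gr_tangent P (kahlerJ P X).
Proof.
move=> gP tX; have PXP := gr_tangent_PXP gP tX; have PP := grassmannian_idem gP.
split; rewrite /kahlerJ.
  rewrite trmxC_iZ trmxCB !trmxCM (gr_tangent_trmxC tX) (grassmannian_trmxC gP) -scalerN.
  by rewrite opprB.
rewrite -scalemxAl -scalemxAr -scalerDr mulmxBl mulmxBr -(mulmxA X P P) PP PXP subr0.
by rewrite !mulmxA PXP PP sub0r.
Qed.

Lemma kahlerJK P X : grassmannian2 P -> gr_tangent P X -> kahlerJ P (kahlerJ P X) = - X.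
Proof.
move=> gP tX; have PXP := gr_tangent_PXP gP tX; have PP := grassmannian_idem gP.
rewrite /kahlerJ -scalemxAl -scalemxAr -scalerBr scalerA -expr2 sqr_i scaleN1r; congr (- _).
rewrite mulmxBl mulmxBr -(mulmxA X P P) PP !mulmxA PXP PP subr0 sub0r opprK.
by have [] := tX.
Qed.

Lemma kahlerJN P X : kahlerJ P (- X) = - kahlerJ P X.
Proof. by rewrite /kahlerJ mulNmx mulmxN -opprD scalerN. Qed.

Lemma kahlerJZ P a X : kahlerJ P (a%:C *: X) = a%:C *: kahlerJ P X.
Proof. by rewrite /kahlerJ -scalemxAl -scalemxAr -scalerBr !scalerA mulrC. Qed.

Lemma g_kahlerJ P X Y : grassmannian2 P -> gr_tangent P Y ->
  g (kahlerJ P X) Y = - g X (kahlerJ P Y).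
Proof.
move=> gP tY; rewrite /g (gr_tangent_trmxC tY) (gr_tangent_trmxC (kahlerJ_tangent gP tY)).
have E : \tr ((X *m P - P *m X) *m Y) = - \tr (X *m (Y *m P - P *m Y)).
  rewrite mulmxBl mulmxBr !mxtraceB opprB; congr (_ - _); first by rewrite mulmxA.
  by rewrite -mulmxA mxtrace_mulC mulmxA.
by rewrite /kahlerJ -scalemxAl -scalemxAr !mxtraceZ E mulrN cReN mulrN.
Qed.

Lemma g_kahlerJ_self P X : grassmannian2 P -> gr_tangent P X -> g (kahlerJ P X) X = 0.
Proof. by move=> gP tX; have := g_kahlerJ X gP tX; rewrite (gC X) => E; lra. Qed.

Lemma kahlerJ_isometry P X : grassmannian2 P -> gr_tangent P X ->
  g (kahlerJ P X) (kahlerJ P X) = g X X.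
Proof.
by move=> gP tX; rewrite g_kahlerJ ?kahlerJK ?gNr ?opprK//; exact: kahlerJ_tangent.
Qed.

Lemma gr_second_form0 P X : gr_second_form P 0 X = 0.
Proof. by rewrite /gr_second_form mul0mx mulmx0 addr0 mulmx0. Qed.

End KahlerStructure.

(** * The Ricci tensor of the hypersurface on the Reeb field *)

Lemma opp_lin_arith (R : comPzRingType) (a x y z x' y' z' : R) :
  x = - x' -> y = - y' -> z = - z' -> x' = a * y' + z' -> x = a * y + z.
Proof. by move=> -> -> -> ->; ring. Qed.

Lemma opp_add_arith (R : comPzRingType) (x y z t : R) : x + y - (z + t) = x - z + (y - t).
Proof. by ring. Qed.

Lemma vanish_arith (R : comPzRingType) (x a b c d e f : R) :
  x = a * b - c * d + (e - f) -> b = 0 -> c = 0 -> e = 0 -> f = 0 -> x = 0.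
Proof. by move=> -> -> -> -> ->; ring. Qed.

Lemma ricci_arith (R : comPzRingType) (h a t c : R) :
  h * (a * t) - a * (a * t) + c * t = (c + a * h - a ^+ 2) * t.
Proof. by ring. Qed.

Section HypersurfaceRicci.
Context {R : realType} {m : nat} {M : hypersurface R m}.
Notation n := (4 * m - 1)%N.
Implicit Types (p q : M) (x y z v w : cmx R m).

Variables (W : set M) (N : M -> cmx R m).
Hypotheses (W_open : open W) (N_normal : unit_normal W N) (m_ge3 : (3 <= m)%N).
Notation A := (shape_operator N).

Lemma unit_normalP p : W p ->
  [/\ gr_tangent (imm p) (N p), g (N p) (N p) = 1 & forall v, tangent p v -> g (N p) v = 0].
Proof. exact: N_normal.2. Qed.

Lemma componentsD p v v' : tangent p v -> tangent p v' ->
  components p (v + v') = components p v + components p v'.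
Proof.
move=> [w ->] [w' ->]; rewrite -coord_fieldD ?components_coord_field//; exact: chart_img_self.
Qed.

Lemma componentsZ p (a : R) v : tangent p v -> components p (a%:C *: v) = a *: components p v.
Proof.
move=> [w ->]; rewrite -coord_fieldZ ?components_coord_field//; exact: chart_img_self.
Qed.

Lemma dir_normal_lin p (a : R) v v' : W p -> tangent p v -> tangent p v' ->
  dir_mx N p (a%:C *: v + v') = a%:C *: dir_mx N p v + dir_mx N p v'.
Proof.
move=> Wp tv tv'; rewrite /dir_mx componentsD ?componentsZ//; last exact: tangentZ.
apply: derive_cmx_lin.
exact: smooth_mx_differentiable W_open N_normal.1 Wp (chart_img_self p).
Qed.

Lemma shape_operator0 p x : gr_tangent (imm p) x -> g (A p 0) x = 0.
Proof. by move=> tx; rewrite g_shape_operator// dir_mx0 g0l oppr0. Qed.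

Lemma g_shape_operator_lin p (a : R) v v' x : W p -> tangent p v -> tangent p v' ->
  gr_tangent (imm p) x -> g (A p (a%:C *: v + v')) x = a * g (A p v) x + g (A p v') x.
Proof.
move=> Wp tv tv' tx.
have E u : g (A p u) x = - g (dir_mx N p u) x by exact: g_shape_operator.
have D : g (dir_mx N p (a%:C *: v + v')) x = a * g (dir_mx N p v) x + g (dir_mx N p v') x.
  by rewrite dir_normal_lin// gDl gZl.
exact: opp_lin_arith (E _) (E _) (E _) D.
Qed.

Lemma g_shape_operator_sum p (I : finType) (s : I -> R) (v : I -> cmx R m) x : W p ->
  (forall i, tangent p (v i)) -> gr_tangent (imm p) x ->
  g (A p (\sum_i (s i)%:C *: v i)) x = \sum_i s i * g (A p (v i)) x.
Proof.
move=> Wp tv tx.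
(* Tangency of the partial sums is carried along, since linearity of the shape operator is available
   on tangent vectors only. *)
have : tangent p (\sum_i (s i)%:C *: v i) /\
    g (A p (\sum_i (s i)%:C *: v i)) x = \sum_i s i * g (A p (v i)) x; last by case.
elim: (index_enum I) => [|i r IH].
  by rewrite !big_nil shape_operator0//; split => //; exact: tangent0.
have [tr E] := IH; have tvi := tv i; rewrite !big_cons; split.
  by apply: tangentD => //; exact: tangentZ.
exact: etrans (g_shape_operator_lin (s i) Wp tvi tr tx) (congr1 (fun t => s i * g (A p (v i)) x + t) E).
Qed.

Variable nabla : (M -> cmx R m) -> (M -> cmx R m) -> M -> cmx R m.
Hypothesis nabla_LC : levi_civita nabla.

Lemma gauss_shape p x y z w : W p -> tangent p x -> tangent p y -> tangent p z -> tangent p w ->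
  let B := gr_second_form (imm p) in
  g (riemann nabla p x y z) w =
  g z (A p y) * g w (A p x) - g z (A p x) * g w (A p y)
  + (g (B y z) (B x w) - g (B x z) (B y w)).
Proof.
move=> Wp tx ty tz tw /=; have gP := imm_grassmannian p.
have [tN gN _] := unit_normalP Wp.
have expand (s t : R) u1 u2 u3 u4 : tangent p u1 -> tangent p u2 -> tangent p u3 -> tangent p u4 ->
    g (s%:C *: N p + gr_second_form (imm p) u1 u2) (t%:C *: N p + gr_second_form (imm p) u3 u4) =
    s * t + g (gr_second_form (imm p) u1 u2) (gr_second_form (imm p) u3 u4).
  move=> /tangent_gr_tangent t1 /tangent_gr_tangent t2 /tangent_gr_tangent t3 /tangent_gr_tangent t4.
  have n1 := gr_second_form_normal gP t1 t2 tN; have n2 := gr_second_form_normal gP t3 t4 tN.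
  rewrite !gDl !gDr !gZl !gZr gN n1 (gC (N p)) n2.
  by rewrite mulr1 !mulr0 addr0 add0r.
have np b c := normal_partE nabla_LC W_open N_normal m_ge3 b c Wp.
move: tx ty tz tw => [a ->] [b ->] [c ->] [d ->].
have tc := @tangent_coord_self _ _ M p.
rewrite (gauss_equation nabla_LC) (np b c) (np a d) (np a c) (np b d).
apply: (etrans (congr2 (fun s t : R => s - t)
  (expand _ _ _ _ _ _ (tc b) (tc c) (tc a) (tc d))
  (expand _ _ _ _ _ _ (tc a) (tc c) (tc b) (tc d)))).
exact: opp_add_arith.
Qed.

Lemma ricci_tangent p x : tangent p (ricci nabla p x).
Proof. by apply: tangent_sum => i; exact: riemann_tangent. Qed.

(** The parallelism condition evaluates the Ricci tensor at nabla_xi xi = 0, and its definition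
    through curvature of extended fields does not display linearity. *)
Lemma ricci0 p : W p -> ricci nabla p 0 = 0.
Proof.
move=> Wp; apply: (tangent_eq (ricci_tangent p 0) (tangent0 p)) => w tw.
have g0 u : tangent p u -> g u (A p 0) = 0.
  by move=> tu; rewrite gC shape_operator0//; exact: tangent_gr_tangent.
rewrite g0l /ricci g_suml big1// => i _; have ti := (frameP p).1 i.
have B1 : g (gr_second_form (imm p) (frame p i) (frame p i)) (gr_second_form (imm p) 0 w) = 0.
  by rewrite gr_second_form0 g0r.
have B2 : g (gr_second_form (imm p) 0 (frame p i)) (gr_second_form (imm p) (frame p i) w) = 0.
  by rewrite gr_second_form0 g0l.
exact: vanish_arith (gauss_shape Wp (tangent0 p) ti ti tw) (g0 _ tw) (g0 _ ti) B1 B2.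
Qed.

Lemma reeb_gr_tangent p : W p -> gr_tangent (imm p) (reeb N p).
Proof.
move=> Wp; have [tN _ _] := unit_normalP Wp; apply: gr_tangentN.
by apply: kahlerJ_tangent => //; exact: imm_grassmannian.
Qed.

Lemma reeb_tangent p : W p -> tangent p (reeb N p).
Proof.
move=> Wp; have [tN _ _] := unit_normalP Wp.
apply: (tangent_of_orthogonal N_normal m_ge3 Wp); first exact: reeb_gr_tangent.
by rewrite gNl g_kahlerJ_self ?oppr0//; exact: imm_grassmannian.
Qed.

Lemma reeb_unit p : W p -> g (reeb N p) (reeb N p) = 1.
Proof.
move=> Wp; have [tN gN _] := unit_normalP Wp.
by rewrite gNl gNr opprK kahlerJ_isometry//; exact: imm_grassmannian.
Qed.

Lemma kahlerJ_reeb p : W p -> kahlerJ (imm p) (reeb N p) = N p.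
Proof.
move=> Wp; have [tN _ _] := unit_normalP Wp.
by rewrite kahlerJN kahlerJK ?opprK//; exact: imm_grassmannian.
Qed.

Lemma phi_reeb p (a : R) : W p -> phi p (a%:C *: reeb N p) = 0.
Proof.
move=> Wp; have [_ _ oN] := unit_normalP Wp.
rewrite /phi kahlerJZ kahlerJ_reeb//; apply: oproj_tangent; first exact: tangent0.
by move=> z tz; rewrite subr0 gZl oN// mulr0.
Qed.

Lemma ricci_reeb p (alpha : R) : W p ->
  A p (reeb N p) = alpha%:C *: reeb N p -> Qperp N p (reeb N p) ->
  ricci nabla p (reeb N p) =
  ((4 * m)%:R + alpha * trace_shape N p - alpha ^+ 2)%:C *: reeb N p.
Proof.
move=> Wp hopf [J [a [[qJ _] xiE]]]; have [tN gN oN] := unit_normalP Wp.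
have gP := imm_grassmannian p; have [te oe] := frameP p.
have te' i := tangent_gr_tangent (te i).
have txi := reeb_tangent Wp; have txi' := reeb_gr_tangent Wp.
have [C [PC CP trC NC]] := quaternionic_annihilator gP tN qJ xiE.
have N3 := singular_cube gP tN gN PC CP trC NC.
apply: (tangent_eq (ricci_tangent _ _)) => [|w tw]; first exact: tangentZ.
have tw' := tangent_gr_tangent tw.
rewrite gZl /ricci g_suml.
rewrite (eq_bigr _ (fun i _ => gauss_shape Wp txi (te i) (te i) tw)) big_split /=.
rewrite (gr_ricci_sum gP tN gN te' (fun i => oN _ (te i)) oe (dimE m_ge3) N3 tw' txi').
have gA u : g u (A p (reeb N p)) = alpha * g (reeb N p) u by rewrite hopf gZr gC.
have S1 : \sum_i g (frame p i) (A p (frame p i)) * g w (A p (reeb N p)) =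
    trace_shape N p * (alpha * g (reeb N p) w).
  rewrite gA /trace_shape mulr_suml; apply: eq_bigr => i _.
  by rewrite (gC (frame p i)).
(* The Hopf condition turns the first factors into [alpha] times the frame components of xi, so the
   sum reassembles [A] applied to xi. *)
have S2 : \sum_i g (frame p i) (A p (reeb N p)) * g w (A p (frame p i)) =
    alpha * (alpha * g (reeb N p) w).
  have S3 := etrans (congr1 (fun v => g (A p v) w) (tangent_expand N_normal m_ge3 Wp txi))
    (g_shape_operator_sum (fun i => g (reeb N p) (frame p i)) Wp te tw').
  transitivity (alpha * g (A p (reeb N p)) w); last by rewrite hopf gZl.
  rewrite S3 mulr_sumr; apply: eq_bigr => i _.
  by rewrite gA (gC w (A p (frame p i))) mulrA.
exact: etrans (congr2 (fun s t => s + t) (etrans (sumrB _ _ _ _) (congr2 (fun s t => s - t) S1 S2)) erefl)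
  (ricci_arith _ _ _ _).
Qed.

End HypersurfaceRicci.

(** * Smoothness of the trace of the shape operator *)

Section TraceSmooth.
Context {R : realType} {m : nat} {M : hypersurface R m}.
Notation n := (4 * m - 1)%N.
Variables (W : set M) (N : M -> cmx R m).
Hypotheses (W_open : open W) (N_normal : unit_normal W N) (m_ge3 : (3 <= m)%N).
Implicit Types (p q : M).
Notation A := (shape_operator N).

(** [C] expresses a basis in an orthonormal frame: the Gram matrix and the matrix of the bilinear
    form both change by congruence, and their quotient has the trace of the endomorphism. *)
Lemma mxtrace_congruence (F : fieldType) k (C a : 'M[F]_k) : C *m C^T \in unitmx ->
  \tr (invmx (C *m C^T) *m (C *m a *m C^T)) = \tr a.
Proof.
move=> uG; have E : C^T *m invmx (C *m C^T) *m C = 1%:M.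
  by apply: mulmx1C; rewrite mulmxA mulmxV.
by rewrite mulmxA mxtrace_mulC !mulmxA E mul1mx.
Qed.

(* The frame of the definition of trace_shape is chosen pointwise and is not
   smooth; the coordinate fields are. *)
Lemma trace_shape_basis q (v : 'I_n -> cmx R m) : W q -> (forall i, tangent q (v i)) ->
  (\matrix_(i, j) g (v i) (v j)) \in unitmx ->
  trace_shape N q = \tr (invmx (\matrix_(i, j) g (v i) (v j)) *m
                         \matrix_(i, j) g (A q (v i)) (v j)).
Proof.
move=> Wq tv uG; have [te oe] := frameP q.
pose C : 'M[R]_n := \matrix_(i, j) g (v i) (frame q j).
pose a : 'M[R]_n := \matrix_(i, j) g (A q (frame q i)) (frame q j).
have vE i := tangent_expand N_normal m_ge3 Wq (tv i).
have gv x i : g x (v i) = \sum_l g x (frame q l) * g (v i) (frame q l).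
  rewrite {1}(vE i) g_sumr; apply: eq_bigr => l _; by rewrite gZr mulrC.
have GE : \matrix_(i, j) g (v i) (v j) = C *m C^T.
  by apply/matrixP => i j; rewrite !mxE gv; apply: eq_bigr => l _; rewrite !mxE.
have HE : \matrix_(i, j) g (A q (v i)) (v j) = C *m a *m C^T.
  apply/matrixP => i j; rewrite mxE gv [RHS]mxE; apply: eq_bigr => l _; rewrite !mxE.
  congr (_ * _).
  have te' := tangent_gr_tangent (te l).
  apply: (etrans (congr1 (fun x => g (A q x) (frame q l)) (vE i))).
  apply: (etrans (g_shape_operator_sum W_open N_normal (fun j => g (v i) (frame q j)) Wq te te')).
  by apply: eq_bigr => k _; rewrite !mxE.
by rewrite HE; move: uG; rewrite GE => uG; rewrite mxtrace_congruence// /mxtrace; apply: eq_bigr => i _; rewrite mxE.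
Qed.

Definition gram p (u : 'rV[R]_n) : 'M[R]_n := \matrix_(i, j)
  g (Defs.derive_mx (fun u => imm (par p u)) (delta_mx ord0 i) u)
    (Defs.derive_mx (fun u => imm (par p u)) (delta_mx ord0 j) u).

(** A kernel vector of the Gram matrix would give a tangent vector of length zero, which the
    immersion condition at the centre of the chart excludes. *)
Lemma gram_unit p : gram p (coord p p) \in unitmx.
Proof.
rewrite -row_free_unit -kermx_eq0; apply: contraT => ker0.
pose w := nz_row (kermx (gram p (coord p p))).
have w0 : w != 0 by rewrite nz_row_eq0.
have wG : w *m gram p (coord p p) = 0 by apply/sub_kermxP; exact: nz_row_sub.
have ip := chart_img_self p.
have vE := coord_field_sum w ip.
have vc j : g (coord_field p w p) (coord_field p (delta_mx ord0 j) p) = 0.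
  rewrite vE g_suml; have := congr1 (fun B : 'M[R]_(1, n) => B ord0 j) wG.
  rewrite /= !mxE => E; rewrite -[RHS]E.
  by apply: eq_bigr => i _; rewrite gZl mxE.
have v0 : g (coord_field p w p) (coord_field p w p) = 0.
  by rewrite {2}vE g_sumr big1// => i _; rewrite gZr vc mulr0.
case/eqP: w0; apply: (@coord_field_inj _ _ _ p).
by rewrite coord_field0//; exact: g_eq0.
Qed.

Lemma smooth_trace_shape : smooth W (trace_shape N).
Proof.
apply: smooth_local => p Wp; have ip := chart_img_self p.
have sF := imm_smooth_chart p; have od : open (dom p) by exact: dom_open.
have oW : open (chart_pre p W) by exact: open_chart_pre.
have sFW i : smooth_cmx (chart_pre p W)
    (Defs.derive_mx (fun u => imm (par p u)) (delta_mx ord0 i)).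
  by apply: smooth_cmx_derive; apply: smooth_cmx_sub sF => u [].
have sNW i : smooth_cmx (chart_pre p W)
    (Defs.derive_mx (fun u => N (par p u)) (delta_mx ord0 i)).
  by apply: smooth_cmx_derive; have /smooth_mxE := N_normal.1; exact.
have sG i j : smooth_on (chart_pre p W) (fun u => gram p u i j).
  apply: eq_smooth_on (smooth_on_g oW (sFW i) (sFW j)) => // u _.
  by rewrite mxE.
have sdet := smooth_on_det oW sG.
(* Invertibility of the Gram matrix is known at the centre; it persists where its continuous
   determinant does not vanish. *)
pose U : set 'rV[R]_n := chart_pre p W `&` (fun u => \det (gram p u)) @^-1` [set x : R | x != 0].
have oU : open U.
  apply: open_setI_preimage => //.
  by move=> u Uu; apply: differentiable_continuous; exact: smooth_on_diff sdet Uu.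
have UW : U `<=` chart_pre p W by move=> u [].
have Ud : U `<=` dom p by move=> u [[]].
have uG u : U u -> gram p u \in unitmx by move=> [_ d0]; rewrite unitmxE unitfE.
exists (par p @` U); split.
  exists (coord p p); last exact: coordK.
  split; first exact: chart_pre_coord.
  by rewrite /preimage /= -unitfE -unitmxE; exact: gram_unit.
apply: smooth_chart => //.
(* Against tangent vectors the projection in the shape operator disappears, and what remains is a
   manifestly smooth derivative of [N]. *)
pose H (u : 'rV[R]_n) : 'M[R]_n := \matrix_(i, j)
  - g (Defs.derive_mx (fun u => N (par p u)) (delta_mx ord0 i) u)
      (Defs.derive_mx (fun u => imm (par p u)) (delta_mx ord0 j) u).
apply: (eq_smooth_on oU (f := fun u => \sum_i \sum_j invmx (gram p u) i j * H u j i)).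
  move=> u Uu; have [[du Wu] _] := Uu; have iu : chart_img p (par p u) by exists u.
  pose v (i : 'I_n) := coord_field p (delta_mx ord0 i) (par p u).
  have tv i : tangent (par p u) (v i) by exact: tangent_coord_field.
  have GE : \matrix_(i, j) g (v i) (v j) = gram p u.
    by apply/matrixP => i j; rewrite !mxE /v !coord_field_par.
  have HE : \matrix_(i, j) g (A (par p u) (v i)) (v j) = H u.
    apply/matrixP => i j; rewrite !mxE.
    apply: (etrans (g_shape_operator _ _ (tangent_gr_tangent (tv j)))); congr (- _).
    rewrite /v (dir_mx_coord_field (delta_mx ord0 i) W_open N_normal.1 Wu iu).
    by rewrite (parK du) coord_field_par.
  have uG' : (\matrix_(i, j) g (v i) (v j)) \in unitmx by rewrite GE; exact: uG.
  have := trace_shape_basis Wu tv uG'; rewrite GE HE => ->.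
  by apply: eq_bigr => i _; rewrite mxE.
apply: smooth_on_sum => [//|i]; apply: smooth_on_sum => [//|j].
apply: (smooth_onM oU).
  apply: smooth_on_invmx => // i' j'; exact: smooth_on_sub UW (sG i' j').
apply: (eq_smooth_on oU (f := fun u =>
  - g (Defs.derive_mx (fun u => N (par p u)) (delta_mx ord0 j) u)
      (Defs.derive_mx (fun u => imm (par p u)) (delta_mx ord0 i) u))).
  by move=> u _; rewrite mxE.
apply: (smooth_onN oU); apply: smooth_on_sub UW _.
exact: smooth_on_g.
Qed.

End TraceSmooth.

(** * Derivatives of the Reeb field *)

Section ReebDirection.
Context {R : realType} {m : nat} {M : hypersurface R m}.
Notation n := (4 * m - 1)%N.
Variables (W : set M) (N : M -> cmx R m).
Hypotheses (W_open : open W) (N_normal : unit_normal W N) (m_ge3 : (3 <= m)%N).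
Variable nabla : (M -> cmx R m) -> (M -> cmx R m) -> M -> cmx R m.
Hypothesis nabla_LC : levi_civita nabla.
Implicit Types (p q : M).
Notation A := (shape_operator N).

Lemma vector_field_reeb : vector_field W (reeb N).
Proof.
split; last by move=> p Wp; exact: reeb_tangent N_normal m_ge3 _ Wp.
apply/smooth_mxE => p; have oU := open_chart_pre (p := p) W_open.
have sN : smooth_cmx (chart_pre p W) (fun u => N (par p u)).
  by have /smooth_mxE := N_normal.1; exact.
have sP : smooth_cmx (chart_pre p W) (fun u => imm (par p u)).
  by apply: smooth_cmx_sub (imm_smooth_chart p) => u [].
apply: smooth_cmxN => //; apply: smooth_cmxZc => //; apply: smooth_cmxD => //.
  exact: smooth_cmxM.
by apply: smooth_cmxN => //; exact: smooth_cmxM.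
Qed.

Lemma dir_reeb p v : W p -> dir_mx (reeb N) p v =
  - kahlerJ (imm p) (dir_mx N p v) -
  'i%C *: (N p *m dir_mx (@imm _ _ M) p v - dir_mx (@imm _ _ M) p v *m N p).
Proof.
move=> Wp; have ip := chart_img_self p.
have dN := differentiable_is_derive (components p v)
  (smooth_mx_differentiable W_open N_normal.1 Wp ip).
have dP := differentiable_is_derive (components p v) (imm_differentiable (dom_coord ip)).
have d1 := is_derive_cmxB (is_derive_cmxM dN dP) (is_derive_cmxM dP dN).
have d2 := is_derive_cmxP (is_derive_cmxN (is_derive_cmxZc 'i%C d1)).
apply: (etrans d2); rewrite (coordK ip) -/(dir_mx N p v) -/(dir_mx (@imm _ _ M) p v).
move: (dir_mx N p v) (dir_mx (@imm _ _ M) p v) (N p) (imm p) => D V X P.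
by rewrite /kahlerJ -opprD -scalerDr; congr (- (_ *: _)); move: (D *m P) (X *m V) (V *m X) (P *m D) => a b c d; mx_ring.
Qed.

Lemma dir_imm p v : tangent p v -> dir_mx (@imm _ _ M) p v = v.
Proof. by move=> tv; rewrite -{2}(coord_field_components tv). Qed.

(** Differentiating the point [P] inside [kahlerJ] produces a commutator of two tangent vectors,
    which is block diagonal and hence orthogonal to [w]. This is the parallelism of J. *)
Lemma g_dir_reeb p v w : W p -> tangent p v -> gr_tangent (imm p) w ->
  g (dir_mx (reeb N) p v) w = - g (A p v) (kahlerJ (imm p) w).
Proof.
move=> Wp tv tw; have gP := imm_grassmannian p; have [tN _ _] := unit_normalP N_normal Wp.
have tv' := tangent_gr_tangent tv.
have K0 : g ('i%C *: (N p *m v - v *m N p)) w = 0.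
  apply: (block_diagonal_normal gP tw); rewrite -scalemxAl -scalemxAr; congr (_ *: _).
  by rewrite mulmxBr mulmxBl !tangent_mul_comm.
apply: (etrans (congr1 (g^~ w) (dir_reeb v Wp))); rewrite (dir_imm tv) gBl K0 subr0 gNl.
rewrite (g_kahlerJ _ gP tw) opprK (g_shape_operator _ _ (kahlerJ_tangent gP tw)) opprK.
by [].
Qed.

(** In general nabla_X xi = phi A X; here A xi is a multiple of xi, and J xi = N is normal to
    [M]. *)
Lemma nabla_reeb_reeb p (alpha : R) : W p -> A p (reeb N p) = alpha%:C *: reeb N p ->
  nabla (reeb N) (reeb N) p = 0.
Proof.
move=> Wp hopf; have [tN _ oN] := unit_normalP N_normal Wp.
have vxi := vector_field_reeb; have gP := imm_grassmannian p.
have tn := (nabla_vector_field nabla_LC W_open vxi vxi).2 p Wp.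
apply: (tangent_eq tn (tangent0 p)) => w tw.
have tw' := tangent_gr_tangent tw; have txi := vxi.2 p Wp.
have txi' := tangent_gr_tangent txi.
rewrite (levi_civita_tangential nabla_LC W_open vxi vxi Wp tw) g0l.
rewrite (g_dir_reeb Wp txi tw') hopf gZl.
have := g_kahlerJ (reeb N p) gP tw'; rewrite (kahlerJ_reeb N_normal Wp) (oN _ tw) => E.
by rewrite -mulrN -E mulr0.
Qed.

End ReebDirection.

Lemma dir_affine (R : realType) (m : nat) (M : hypersurface R m) (f h : M -> R) (W : set M)
    (a b : R) (p : M) (v : cmx R m) :
  open W -> W p -> smooth W f -> (forall q, W q -> h q = b + a * f q) ->
  dir h p v = a * dir f p v.
Proof.
move=> oW Wp sf hE; have ip := chart_img_self p.
have df : differentiable (fun u => f (par p u)) (coord p p).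
  by apply: smooth_on_diff (sf p) _; exact: chart_pre_coord.
have nE : \forall u \near coord p p, h (par p u) = b + a * f (par p u).
  by apply: filterS (near_chart oW Wp ip) => u [_ Wu]; exact: hE.
apply: (etrans (near_eq_derive _ nE)).
have [_ E] := is_deriveD (is_derive_cst b (coord p p) (components p v))
  (is_derive_mul (is_derive_cst a (coord p p) (components p v))
     (derivableP (diff_derivable (v := components p v) df))).
by apply: etrans E _; rewrite mul0r !add0r.
Qed.

Theorem mainTheorem6 (R : realType) (m : nat) (k : R) (M : hypersurface R m)
    (nabla : (M -> cmx R m) -> (M -> cmx R m) -> M -> cmx R m)
    (W : set M) (N : M -> cmx R m) (alpha : M -> R)
    (m_ge3 : (3 <= m)%N)
    (k_neq0 : k != 0)
    (nabla_LC : levi_civita nabla)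
    (W_open : open W)
    (N_normal : unit_normal W N)
    (hopf : forall p, W p -> shape_operator N p (reeb N p) = (alpha p)%:C *: reeb N p)
    (alphaE : forall p, W p -> alpha p = 2%:R * k)
    (ricci_parallel : forall Y, vector_field W Y ->
       forall p, W p -> gtw_tensor nabla N k (ricci nabla) (reeb N) Y p = 0)
    (xi_Qperp : forall p, W p -> Qperp N p (reeb N p)) :
  forall p, W p -> dir (trace_shape N) p (reeb N p) = 0.
Proof.
move=> p Wp; have ip := chart_img_self p.
pose f q := (4 * m)%:R - (2 * k) ^+ 2 + 2 * k * trace_shape N q.
have hopf' q : W q -> shape_operator N q (reeb N q) = (2 * k)%:C *: reeb N q.
  by move=> Wq; rewrite hopf// alphaE.
have ricciE q : W q -> ricci nabla q (reeb N q) = (f q)%:C *: reeb N q.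
  move=> Wq; rewrite (ricci_reeb W_open N_normal m_ge3 nabla_LC Wq (hopf' q Wq) (xi_Qperp q Wq)).
  by rewrite /f addrAC.
have vxi := vector_field_reeb W_open N_normal m_ge3.
have txi := vxi.2 p Wp; have txi' := tangent_gr_tangent txi.
have sh := smooth_trace_shape W_open N_normal m_ge3.
have sf : smooth W f.
  move=> q; have oU := open_chart_pre (p := q) W_open.
  apply: smooth_onD => //; first exact: smooth_on_cst.
  by apply: smooth_onM => //; exact: smooth_on_cst.
(* [ricci] uses extensions and frames that vary with the point, so smoothness is obtained from the
   multiple of xi that it equals on [W]. *)
have vS : vector_field W (fun q => ricci nabla q (reeb N q)).
  split; last by move=> q _; exact: ricci_tangent.
  apply: (eq_smooth_mx (F := fun q => (f q)%:C *: reeb N q) W_open) => [q Wq|].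
    by rewrite ricciE.
  apply/smooth_mxE => q; have oU := open_chart_pre (p := q) W_open.
  by apply: smooth_cmxZ => //; [exact: sf|have /smooth_mxE := vxi.1; exact].
have nn := nabla_reeb_reeb W_open N_normal m_ge3 nabla_LC Wp (hopf' p Wp).
have phi0 := phi_reeb N_normal _ Wp.
(* All three correction terms contain phi of a multiple of xi. The condition on [Y] is pointwise, so
   it covers both xi and S xi. *)
have gtwE Y (c : R) : Y p = c%:C *: reeb N p -> gtw nabla N k (reeb N) Y p = nabla (reeb N) Y p.
  move=> Yp; rewrite /gtw hopf'// Yp !phi0 g0l scale0r scaler0 scaler0.
  by rewrite addr0 !subr0.
have := ricci_parallel _ vxi p Wp; rewrite /gtw_tensor.
rewrite (gtwE _ (f p)) ?ricciE// (gtwE _ 1) ?scale1r// nn.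
rewrite (ricci0 W_open N_normal m_ge3 nabla_LC Wp) subr0 => nS.
(* Testing the vanishing derivative of S xi against xi reduces the vector equation to a scalar
   one. *)
have := levi_civita_tangential nabla_LC W_open vxi vS Wp txi; rewrite nS g0l.
have sxi := vxi.1.
have df : differentiable (fun u => f (par p u)) (coord p p).
  by apply: smooth_on_diff (sf p) _; exact: chart_pre_coord.
have dxi := differentiable_is_derive (components p (reeb N p))
  (smooth_mx_differentiable W_open sxi Wp ip).
have dfxi := is_derive_cmxZ (derivableP (diff_derivable (v := components p (reeb N p)) df)) dxi.
have nE : \forall u \near coord p p, (f (par p u))%:C *: reeb N (par p u) =
    ricci nabla (par p u) (reeb N (par p u)).
  by apply: filterS (near_chart W_open Wp ip) => u [_ Wu]; rewrite ricciE.
have := is_derive_cmxP (near_is_derive_cmx nE dfxi).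
rewrite -/(dir_mx (fun q => ricci nabla q (reeb N q)) p (reeb N p)) => ->.
(* This removes the term of the product rule in which xi is differentiated and leaves the derivative
   of [f], which is 2k times that of the trace. *)
have gxx : g (dir_mx (reeb N) p (reeb N p)) (reeb N p) = 0.
  by rewrite -(levi_civita_tangential nabla_LC W_open vxi vxi Wp txi) nn g0l.
rewrite gDl !gZl (coordK ip) (reeb_unit N_normal Wp) mulr1.
rewrite -/(dir_mx (reeb N) p (reeb N p)) gxx mulr0 addr0.
rewrite -/(dir f p (reeb N p)) (dir_affine (reeb N p) W_open Wp sh (fun q _ => erefl)).
by move=> /esym/eqP; rewrite !mulf_eq0 pnatr_eq0 (negbTE k_neq0) => /eqP.
Qed.
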